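(* Let $q_{0},b\in\mathbb{B}$. For the set of all slice regular functions $f:\mathbb{B}\to\mathbb{B}$ with $f(0)=0$ and $f'(0)=b$, the range of values of $f(q_{0})$ (i.e. the set of all $f(q_0)$ as $f$ runs over this set of functions) is the closed ball $\overline{B(c,r)}$, where $$c=\frac{q_{0}b(1-|q_{0}|^{2})}{1-|q_{0}b|^{2}},\qquad r=\frac{|q_{0}|^{2}(1-|b|^{2})}{1-|q_{0}b|^{2}}.$$
   Context: $\mathbb{H}$ denotes the quaternions, $\mathbb{B}=\{q\in\mathbb{H}:|q|<1\}$, $\overline{B(c,r)}=\{q\in\mathbb{H}:|q-c|\le r\}$, $\mathbb{S}=\{q\in\mathbb{H}:q^2=-1\}$; for $I\in\mathbb{S}$, $\mathbb{C}_I=\mathbb{R}\oplus I\mathbb{R}$ and $\mathbb{B}_I=\mathbb{B}\cap\mathbb{C}_I$. A function $f:\mathbb{B}\to\mathbb{H}$ is (left) slice regular if for every $I\in\mathbb{S}$ the restriction $f_I=f|_{\mathbb{B}_I}$ has continuous partial derivatives and $\frac12\left(\frac{\partial}{\partial x}+I\frac{\partial}{\partial y}\right)f_I(x+yI)=0$ on $\mathbb{B}_I$; equivalently $f(q)=\sum_{n\ge0}q^na_n$ on $\mathbb{B}$ with $a_n\in\mathbb{H}$. Its slice derivative is $f'(x+yI)=\frac12\left(\frac{\partial}{\partial x}-I\frac{\partial}{\partial y}\right)f_I(x+yI)$, i.e. $f'(q)=\sum_{n\ge1}q^{n-1}na_n$. *)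

(* Defs.v *)
From Stdlib Require Import Reals.
From Coquelicot Require Import Coquelicot.

Open Scope R_scope.

(** [(x0, x1, x2, x3)] stands for [x0 + x1 i + x2 j + x3 k].  As an iterated
    product of [R], [quat] inherits Coquelicot's (Euclidean) real
    [NormedModule] structure, in which derivatives and continuity are taken. *)
Definition quat : Type := (R * R * R * R)%type.

Definition quat_of_R (x : R) : quat := (x, 0, 0, 0).
Coercion quat_of_R : R >-> quat.

Definition qadd (p q : quat) : quat :=
  let '(p0, p1, p2, p3) := p in
  let '(q0, q1, q2, q3) := q in
  (p0 + q0, p1 + q1, p2 + q2, p3 + q3).

Definition qopp (p : quat) : quat :=
  let '(p0, p1, p2, p3) := p in (- p0, - p1, - p2, - p3).

Definition qsub (p q : quat) : quat := qadd p (qopp q).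

Definition qmul (p q : quat) : quat :=
  let '(p0, p1, p2, p3) := p in
  let '(q0, q1, q2, q3) := q in
  (p0 * q0 - p1 * q1 - p2 * q2 - p3 * q3,
   p0 * q1 + p1 * q0 + p2 * q3 - p3 * q2,
   p0 * q2 - p1 * q3 + p2 * q0 + p3 * q1,
   p0 * q3 + p1 * q2 - p2 * q1 + p3 * q0).

Definition qnorm (p : quat) : R :=
  let '(p0, p1, p2, p3) := p in sqrt (p0 ^ 2 + p1 ^ 2 + p2 ^ 2 + p3 ^ 2).

Declare Scope quat_scope.
Delimit Scope quat_scope with quat.
Bind Scope quat_scope with quat.
Infix "+" := qadd : quat_scope.
Infix "-" := qsub : quat_scope.
Infix "*" := qmul : quat_scope.
Notation "- p" := (qopp p) : quat_scope.

Definition unit_ball (q : quat) : Prop := qnorm q < 1.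

Definition closed_ball (c : quat) (r : R) (q : quat) : Prop :=
  qnorm (q - c)%quat <= r.

Definition imag_unit (I : quat) : Prop := (I * I = - 1)%quat.

Definition slice_point (I : quat) (x y : R) : quat := (x + y * I)%quat.

Definition is_partial_x (f : quat -> quat) (I : quat) (x y : R) (d : quat) :
  Prop := is_derive (fun t : R => f (slice_point I t y)) x d.

Definition is_partial_y (f : quat -> quat) (I : quat) (x y : R) (d : quat) :
  Prop := is_derive (fun t : R => f (slice_point I x t)) y d.

(** Only the values of [f] on the open unit ball matter: [(x, y)] ranges over an
    open disc of the plane, and derivatives and continuity are local. *)
Definition slice_regular (f : quat -> quat) : Prop :=
  forall I : quat, imag_unit I ->
  exists fx fy : R * R -> quat,
  forall x y : R, unit_ball (slice_point I x y) ->
    is_partial_x f I x y (fx (x, y)) /\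
    is_partial_y f I x y (fy (x, y)) /\
    continuous fx (x, y) /\
    continuous fy (x, y) /\
    ((1 / 2)%R * (fx (x, y) + I * fy (x, y)) = 0)%quat.

(** A point [q] lies on several slices (on all of them if [q] is real), so the
    formula is required for every way of writing [q = x + y I]; for slice regular
    [f] the value does not depend on the choice. *)
Definition is_slice_derivative (f : quat -> quat) (q d : quat) : Prop :=
  forall (I : quat) (x y : R), imag_unit I -> q = slice_point I x y ->
  exists dx dy : quat,
    is_partial_x f I x y dx /\
    is_partial_y f I x y dy /\
    d = ((1 / 2)%R * (dx - I * dy))%quat.

(* Main.v *)
Require Import Defs.
From Stdlib Require Import Reals Lra Lia.
From Coquelicot Require Import Coquelicot.

Open Scope R_scope.

(* On each slice Cauchy's formula expands [f] in a power series; the coefficients are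
   determined by the values on the real axis, so [f(q) = sum q^n a_n] with the same [a_n]
   on all slices, [a_0 = 0] and [a_1 = b].

   Extend [f] to the complexification of the quaternions by
   [F(z) = sum z^n a_n].  The norm of left multiplication by [F(r e^{it})] is the maximum of
   [|f|] over the sphere of all [r e^{It}], hence at most [1]; integrating over [t],
   convolution with [(a_n)] is a contraction of [l^2], and so is its adjoint.  The adjoint
   evaluated on combinations of the kernels [(1, 0, 0, ...)] and [(conj(q)^n)] yields, for
   [g = f / q], the two-point Pick inequality
   [(1 - |q|^2) |1 - g(q) conj(b)|^2 <= (1 - |b|^2) (1 - |g(q)|^2)], which says exactly
   that [f(q)] lies in the ball.

   Conversely, for [w = q0 w1] in the ball there is [a], [|a| <= 1], with
   [w1 - b = q0 (1 - w1 conj(b)) a], and the function [g] defined by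
   [g(q) - b = q (1 - g(q) conj(b)) a] makes [q g(q)] slice regular, bounded by [1] and
   equal to [w] at [q0]. *)

(** The obstacle is noncommutativity. The pointwise product of slice regular functions is in general
    not slice regular, and convolving coefficient sequences is not multiplication of values on a
    slice; so one cannot compose with a Möbius map as in the complex Schwarz-Pick lemma. In the
    complexification the variable [z] is central: there convolution is multiplication of values, and
    Parseval's identity applies. The price is that the norm is no longer multiplicative, so an
    operator norm has to replace [|f|]. The adjoint is preferred because it is explicit on kernels:
    it sends [(conj(q)^n)] to [(conj(q^n g(q)))], so that the contraction bound involves only [b],
    [q] and [g(q)]. Limits are kept elementary. Quaternionic series and integrals are seen only
    through the real pairings [qdot e], vectors are cut off at an index [N], and [f] is first
    replaced by the function with coefficients [r^n a_n], [r < 1], where truncation costs little. *)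

(** * Cauchy's formula and Taylor series on the unit disc *)

(* [p + iq] is the derivative of [U + iV]. *)
Definition cauchy_riemann (U V p q : R -> R -> R) : Prop :=
  forall x y, x ^ 2 + y ^ 2 < 1 ->
  (is_derive (fun t => U t y) x (p x y) /\ is_derive (fun t => U x t) y (- q x y)) /\
  (is_derive (fun t => V t y) x (q x y) /\ is_derive (fun t => V x t) y (p x y)) /\
  continuity_2d_pt p x y /\ continuity_2d_pt q x y.

Lemma locally_2d_disc (x y : R) : x ^ 2 + y ^ 2 < 1 ->
  locally_2d (fun u v => u ^ 2 + v ^ 2 < 1) x y.
Proof.
  intros H.
  assert (Hc : continuity_2d_pt (fun u v => u ^ 2 + v ^ 2) x y).
  { apply continuity_2d_pt_plus; simpl; repeat apply continuity_2d_pt_mult;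
      try apply continuity_2d_pt_const; try apply continuity_2d_pt_id1;
      apply continuity_2d_pt_id2. }
  assert (He : 0 < 1 - (x ^ 2 + y ^ 2)) by lra.
  destruct (Hc (mkposreal _ He)) as [d Hd].
  exists d; intros u v Hu Hv; specialize (Hd u v Hu Hv); simpl pos in Hd.
  apply Rabs_def2 in Hd; lra.
Qed.

(** The increment splits into a horizontal step, controlled by the mean value theorem and the
    continuity of [px], and a vertical step at the base point, controlled by [py] there alone; hence
    the asymmetric hypotheses. *)
Lemma differentiable_of_partials (U px py : R -> R -> R) (x y : R) :
  (forall x y, x ^ 2 + y ^ 2 < 1 -> is_derive (fun t => U t y) x (px x y)) ->
  is_derive (fun t => U x t) y (py x y) ->
  continuity_2d_pt px x y -> x ^ 2 + y ^ 2 < 1 ->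
  differentiable_pt_lim U x y (px x y) (py x y).
Proof.
  intros Hx Hy Hc H.
  apply filterdiff_differentiable_pt_lim.
  eapply filterdiff_ext_lin.
  - apply (is_derive_filterdiff U x y px (py x y)).
    + destruct (locally_2d_disc x y H) as [d Hd].
      exists d; intros [u v] [Hu Hv]; apply Hx, Hd; assumption.
    + exact Hy.
    + now apply continuity_2d_pt_filterlim.
  - intros [u v]; reflexivity.
Qed.

Lemma cauchy_riemann_differentiable (U V p q : R -> R -> R) (x y : R) :
  cauchy_riemann U V p q -> x ^ 2 + y ^ 2 < 1 ->
  differentiable_pt_lim U x y (p x y) (- q x y) /\
  differentiable_pt_lim V x y (q x y) (p x y).
Proof.
  intros H Hxy; destruct (H x y Hxy) as [[H1 H2] [[H3 H4] [H5 H6]]]; split.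
  - apply (differentiable_of_partials U p (fun x y => - q x y)); trivial.
    intros u v Huv; apply (H u v Huv).
  - apply (differentiable_of_partials V q p); trivial.
    intros u v Huv; apply (H u v Huv).
Qed.

Lemma cauchy_riemann_continuous (U V p q : R -> R -> R) (x y : R) :
  cauchy_riemann U V p q -> x ^ 2 + y ^ 2 < 1 ->
  continuity_2d_pt U x y /\ continuity_2d_pt V x y.
Proof.
  intros H Hxy; destruct (cauchy_riemann_differentiable U V p q x y H Hxy) as [HU HV].
  split; apply differentiable_continuity_pt; eexists; eexists; eassumption.
Qed.

Lemma is_derive_comp_2d (U : R -> R -> R) (X Y : R -> R) (t lx ly dX dY : R) :
  differentiable_pt_lim U (X t) (Y t) lx ly ->
  is_derive X t dX -> is_derive Y t dY ->
  is_derive (fun t => U (X t) (Y t)) t (lx * dX + ly * dY).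
Proof.
  intros HU HX HY; apply is_derive_Reals.
  apply derivable_pt_lim_comp_2d; trivial; now apply is_derive_Reals.
Qed.

Lemma continuity_2d_pt_comp (f X Y : R -> R -> R) (x y : R) :
  continuity_2d_pt f (X x y) (Y x y) ->
  continuity_2d_pt X x y -> continuity_2d_pt Y x y ->
  continuity_2d_pt (fun u v => f (X u v) (Y u v)) x y.
Proof.
  rewrite !continuity_2d_pt_filterlim; intros Hf HX HY.
  apply (continuous_comp_2 (fun z => X (fst z) (snd z))
    (fun z => Y (fst z) (snd z)) f (x, y) HX HY Hf).
Qed.

(* [ring] and [field] need the carrier to be syntactically [R], not a canonical
   structure over it. *)
Ltac real_eq := match goal with |- @eq _ ?a ?b => change (@eq R a b) end.
Ltac real_ring := real_eq; ring.

(** The triangle inequality in the plane. The weights carry absolute values because the homotopy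
    parameter [t] must be able to leave [[0, 1]] slightly. *)
Lemma segment_in_disc (r phi rho th t : R) :
  Rabs (1 - t) * Rabs r + Rabs t * Rabs rho < 1 ->
  ((1 - t) * (r * cos phi) + t * (rho * cos th)) ^ 2 +
  ((1 - t) * (r * sin phi) + t * (rho * sin th)) ^ 2 < 1.
Proof.
  rewrite <- !Rabs_mult; intros H.
  set (u := (1 - t) * r) in *; set (v := t * rho) in *.
  pose proof (sin2_cos2 phi) as E1; pose proof (sin2_cos2 th) as E2.
  unfold Rsqr in *.
  assert (Hc : Rabs (cos (phi - th)) <= 1) by (apply Rabs_le, COS_bound).
  replace (_ + _) with (u ^ 2 + v ^ 2 + 2 * (u * v * cos (phi - th))).
  2:{ rewrite cos_minus. unfold u, v.
      transitivity (((1 - t) * r) ^ 2 * (sin phi * sin phi + cos phi * cos phi)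
        + (t * rho) ^ 2 * (sin th * sin th + cos th * cos th)
        + 2 * ((1 - t) * r * (t * rho) * (cos phi * cos th + sin phi * sin th)));
        [rewrite E1, E2|]; ring. }
  pose proof (Rle_abs (u * v * cos (phi - th))) as H1.
  rewrite !Rabs_mult in H1.
  pose proof (Rabs_pos u); pose proof (Rabs_pos v).
  assert (Huv : Rabs u * Rabs v * Rabs (cos (phi - th)) <= Rabs u * Rabs v * 1).
  { apply Rmult_le_compat_l; [now apply Rmult_le_pos|exact Hc]. }
  rewrite <- (pow2_abs u), <- (pow2_abs v). nra.
Qed.

Lemma RInt_derive_periodic (f df : R -> R) (a b : R) :
  (forall t, is_derive f t (df t)) -> (forall t, continuous df t) ->
  f a = f b -> RInt df a b = 0.
Proof.
  intros Hd Hc E; apply is_RInt_unique.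
  replace 0 with (minus (f b) (f a))
    by (rewrite E; exact (minus_eq_zero (G := R_AbelianGroup) (f b))).
  now apply (is_RInt_derive f df a b).
Qed.

(* For [F = U + iV] holomorphic and the Cauchy kernel
   [K = rho e^{i th} / (rho e^{i th} - z)], the integral of
   [K F(z + t (rho e^{i th} - z))] over the circle does not depend on [t]: its
   integrand has the [t]-derivative [rho e^{i th} F'], which is a multiple of the
   [th]-derivative of [F(z + t (rho e^{i th} - z))]. *)
Lemma cauchy_homotopy (U V p q : R -> R -> R) (r phi rho : R) (k1 k2 : R -> R) :
  cauchy_riemann U V p q -> Rabs r < 1 -> Rabs rho < 1 ->
  (forall th, continuous k1 th) -> (forall th, continuous k2 th) ->
  (forall th, k1 th * (rho * cos th - r * cos phi)
    - k2 th * (rho * sin th - r * sin phi) = rho * cos th) ->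
  (forall th, k1 th * (rho * sin th - r * sin phi)
    + k2 th * (rho * cos th - r * cos phi) = rho * sin th) ->
  RInt (fun th => k1 th * U (rho * cos th) (rho * sin th)
    - k2 th * V (rho * cos th) (rho * sin th)) 0 (2 * PI) =
  RInt (fun th => k1 th * U (r * cos phi) (r * sin phi)
    - k2 th * V (r * cos phi) (r * sin phi)) 0 (2 * PI).
Proof.
  intros HF Hr Hrho Hk1 Hk2 HK1 HK2.
  set (X := fun t th => (1 - t) * (r * cos phi) + t * (rho * cos th)).
  set (Y := fun t th => (1 - t) * (r * sin phi) + t * (rho * sin th)).
  (* [D t < 1] is an open condition that holds on [[0, 1]], so two-sided derivatives in [t] exist at
     the endpoints as well. *)
  set (D := fun t => Rabs (1 - t) * Rabs r + Rabs t * Rabs rho).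
  assert (HD : forall t th, D t < 1 -> X t th ^ 2 + Y t th ^ 2 < 1)
    by (intros t th; apply segment_in_disc).
  assert (HD01 : forall t, 0 <= t <= 1 -> D t < 1).
  { intros t Ht; unfold D; rewrite (Rabs_pos_eq (1 - t)), (Rabs_pos_eq t) by lra.
    destruct (Rle_lt_dec t (1 / 2)); nra. }
  assert (HDloc : forall t, D t < 1 -> locally t (fun t => D t < 1)).
  { intros t Ht.
    assert (Hc : continuous D t).
    { unfold D; apply (continuous_plus (V := R_NormedModule));
        apply (continuous_mult (K := R_AbsRing)); try apply continuous_const.
      - apply continuous_comp; [|apply continuous_Rabs].
        apply (continuous_minus (V := R_NormedModule));
          [apply continuous_const | apply continuous_id].
      - apply continuous_Rabs. }
    apply (Hc (fun y => y < 1)).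
    apply (open_lt 1); exact Ht. }
  set (f := fun t th => k1 th * U (X t th) (Y t th) - k2 th * V (X t th) (Y t th)).
  set (df := fun t th => rho * cos th * p (X t th) (Y t th)
    - rho * sin th * q (X t th) (Y t th)).
  assert (Hdt : forall t th, D t < 1 -> is_derive (fun t => f t th) t (df t th)).
  { intros t th Ht.
    destruct (cauchy_riemann_differentiable U V p q (X t th) (Y t th) HF (HD t th Ht))
      as [HU HV].
    assert (HX : is_derive (fun t => X t th) t (rho * cos th - r * cos phi))
      by (unfold X; auto_derive; trivial; ring).
    assert (HY : is_derive (fun t => Y t th) t (rho * sin th - r * sin phi))
      by (unfold Y; auto_derive; trivial; ring).
    pose proof (is_derive_comp_2d U (fun t => X t th) (fun t => Y t th) t _ _ _ _
      HU HX HY) as HU'.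
    pose proof (is_derive_comp_2d V (fun t => X t th) (fun t => Y t th) t _ _ _ _
      HV HX HY) as HV'.
    unfold f.
    (* This is the real part of [K F' (rho e^{i th} - z)]; by [HK1] and [HK2] the kernel cancels and
       the real part of [rho e^{i th} F'] remains. *)
    replace (df t th) with (minus (k1 th *
        (p (X t th) (Y t th) * (rho * cos th - r * cos phi)
         + - q (X t th) (Y t th) * (rho * sin th - r * sin phi)))
      (k2 th *
        (q (X t th) (Y t th) * (rho * cos th - r * cos phi)
         + p (X t th) (Y t th) * (rho * sin th - r * sin phi)))).
    - apply (is_derive_minus (V := R_NormedModule));
        apply is_derive_scal; assumption.
    - transitivity (p (X t th) (Y t th) * (k1 th * (rho * cos th - r * cos phi)
          - k2 th * (rho * sin th - r * sin phi))
        - q (X t th) (Y t th) * (k1 th * (rho * sin th - r * sin phi)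
          + k2 th * (rho * cos th - r * cos phi))).
      + unfold minus, plus, opp; simpl; real_ring.
      + rewrite HK1, HK2; unfold df; real_ring. }
  (* The component [V] is the right one: the [th]-derivative of [F] is [i t rho e^{i th} F'], and
     its imaginary part is [t] times the real part [df]. *)
  assert (Hdth : forall t th, D t < 1 ->
    is_derive (fun th => V (X t th) (Y t th)) th (t * df t th)).
  { intros t th Ht.
    destruct (cauchy_riemann_differentiable U V p q (X t th) (Y t th) HF (HD t th Ht))
      as [HU HV].
    assert (HX : is_derive (fun th => X t th) th (- t * rho * sin th))
      by (unfold X; auto_derive; trivial; ring).
    assert (HY : is_derive (fun th => Y t th) th (t * rho * cos th))
      by (unfold Y; auto_derive; trivial; ring).
    pose proof (is_derive_comp_2d V (fun th => X t th) (fun th => Y t th) th _ _ _ _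
      HV HX HY) as HV'.
    replace (t * df t th) with (q (X t th) (Y t th) * (- t * rho * sin th)
      + p (X t th) (Y t th) * (t * rho * cos th)) by (unfold df; ring).
    exact HV'. }
  assert (Hcdf : forall t th, D t < 1 -> continuity_2d_pt df t th).
  { intros t th Ht.
    destruct (HF _ _ (HD t th Ht)) as [_ [_ [Hp Hq]]].
    assert (Hcos : forall g : R -> R, continuity g ->
      continuity_2d_pt (fun _ v => g v) t th).
    { intros g Hg.
      apply (continuity_1d_2d_pt_comp g (fun _ v => v)); [apply Hg|].
      apply continuity_2d_pt_id2. }
    assert (HX : continuity_2d_pt X t th /\ continuity_2d_pt Y t th).
    { split; unfold X, Y; apply continuity_2d_pt_plus;
        repeat apply continuity_2d_pt_mult; try apply continuity_2d_pt_minus;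
        try apply continuity_2d_pt_const; try apply continuity_2d_pt_id1;
        apply Hcos; [apply continuity_cos | apply continuity_sin]. }
    unfold df; apply continuity_2d_pt_minus; apply continuity_2d_pt_mult;
      try (apply continuity_2d_pt_mult; [apply continuity_2d_pt_const|]);
      try (apply continuity_2d_pt_comp; [assumption|apply HX|apply HX]);
      apply Hcos; [apply continuity_cos | apply continuity_sin]. }
  assert (Hcf : forall t th, D t < 1 -> continuous (f t) th).
  { intros t th Ht.
    destruct (cauchy_riemann_differentiable U V p q (X t th) (Y t th) HF (HD t th Ht))
      as [HU HV].
    assert (HX : is_derive (fun th => X t th) th (- t * rho * sin th))
      by (unfold X; auto_derive; trivial; ring).
    assert (HY : is_derive (fun th => Y t th) th (t * rho * cos th))
      by (unfold Y; auto_derive; trivial; ring).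
    unfold f; apply (continuous_minus (V := R_NormedModule));
      apply (continuous_mult (K := R_AbsRing)); try apply Hk1; try apply Hk2.
    - apply (ex_derive_continuous (K := R_AbsRing) (V := R_NormedModule)); eexists.
      apply (is_derive_comp_2d U (fun th => X t th) (fun th => Y t th) th _ _ _ _
        HU HX HY).
    - apply (ex_derive_continuous (K := R_AbsRing) (V := R_NormedModule)); eexists.
      apply (is_derive_comp_2d V (fun th => X t th) (fun th => Y t th) th _ _ _ _
        HV HX HY). }
  assert (Hint : forall t, D t < 1 -> ex_RInt (f t) 0 (2 * PI)).
  { intros t Ht; apply (ex_RInt_continuous (V := R_CompleteNormedModule)).
    intros th _; now apply Hcf. }
  assert (HPhi : forall t, D t < 1 -> is_derive (fun t => RInt (f t) 0 (2 * PI)) t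
    (RInt (df t) 0 (2 * PI))).
  { intros t Ht.
    replace (RInt (df t) 0 (2 * PI))
      with (RInt (fun th => Derive (fun t => f t th) t) 0 (2 * PI)).
    2:{ apply RInt_ext; intros th _; apply is_derive_unique; now apply Hdt. }
    apply (is_derive_RInt_param f).
    - eapply filter_imp; [|exact (HDloc t Ht)]; intros u Hu th _; eexists; now apply Hdt.
    - intros th _; apply (continuity_2d_pt_ext_loc df); [|now apply Hcdf].
      destruct (HDloc t Ht) as [d Hd]; exists d; intros u v Hu _.
      symmetry; apply is_derive_unique, Hdt, Hd, Hu.
    - eapply filter_imp; [|exact (HDloc t Ht)]; exact Hint. }
  (* The factor [t] has to be cancelled, which excludes [t = 0]; the mean value theorem below asks
     only for continuity at the endpoints. *)
  assert (HPhi0 : forall t, 0 < t < 1 -> RInt (df t) 0 (2 * PI) = 0).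
  { intros t Ht.
    assert (Ht1 : D t < 1) by (apply HD01; lra).
    apply (Rmult_eq_reg_l t); [|lra]; rewrite Rmult_0_r.
    assert (Hc : forall th, continuous (df t) th).
    { intros th.
      apply (continuous_comp_2 (fun _ => t) (fun th => th) df th
        (continuous_const t th) (continuous_id th)).
      now apply continuity_2d_pt_filterlim, Hcdf. }
    rewrite <- (RInt_scal (V := R_CompleteNormedModule)).
    2:{ apply (ex_RInt_continuous (V := R_CompleteNormedModule)); intros th _; apply Hc. }
    apply (RInt_derive_periodic (fun th => V (X t th) (Y t th))).
    - intros th; now apply Hdth.
    - intros th; exact (continuous_scal_r (V := R_NormedModule) t (df t) th (Hc th)).
    - unfold X, Y; now rewrite cos_0, sin_0, cos_2PI, sin_2PI. }
  destruct (MVT_gen (fun t => RInt (f t) 0 (2 * PI)) 0 1 (fun _ => 0)) as [c [_ Hc]].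
  - rewrite Rmin_left, Rmax_right by lra; intros t Ht.
    assert (Ht1 : D t < 1) by (apply HD01; lra).
    pose proof (HPhi t Ht1) as Hd; rewrite (HPhi0 t Ht) in Hd; exact Hd.
  - rewrite Rmin_left, Rmax_right by lra; intros t Ht.
    apply continuity_pt_filterlim.
    apply (ex_derive_continuous (V := R_NormedModule) (fun t => RInt (f t) 0 (2 * PI))).
    eexists; apply HPhi, HD01; lra.
  - assert (E : RInt (f 1) 0 (2 * PI) = RInt (f 0) 0 (2 * PI)) by (cbv beta in Hc; lra).
    rewrite (RInt_ext _ (f 1)), E.
    + apply RInt_ext; intros th _; unfold f, X, Y.
      now rewrite !Rminus_0_r, !Rmult_1_l, !Rmult_0_l, !Rplus_0_r.
    + intros th _; unfold f, X, Y.
      now rewrite !Rminus_diag, !Rmult_1_l, !Rmult_0_l, !Rplus_0_l.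
Qed.

(* [kernel_re s t + i kernel_im s t = 1 / (1 - s e^{it})]. *)
Definition kernel_den (s t : R) : R := 1 - 2 * s * cos t + s ^ 2.
Definition kernel_re (s t : R) : R := (1 - s * cos t) / kernel_den s t.
Definition kernel_im (s t : R) : R := s * sin t / kernel_den s t.

Lemma kernel_den_ge (s t : R) : Rabs s < 1 -> (1 - Rabs s) ^ 2 <= kernel_den s t.
Proof.
  intros Hs; unfold kernel_den.
  assert (H : s * cos t <= Rabs s * 1).
  { apply Rle_trans with (1 := Rle_abs _); rewrite Rabs_mult.
    apply Rmult_le_compat_l; [apply Rabs_pos|apply Rabs_le, COS_bound]. }
  rewrite <- (pow2_abs s); nra.
Qed.

Lemma kernel_den_pos (s t : R) : Rabs s < 1 -> 0 < kernel_den s t.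
Proof.
  intros Hs; apply Rlt_le_trans with (2 := kernel_den_ge s t Hs).
  apply pow_lt; lra.
Qed.

Lemma Rabs_div_le (a m b d : R) : 0 < d -> d <= b -> Rabs a <= m -> Rabs (a / b) <= m / d.
Proof.
  intros Hd Hb Ha; unfold Rdiv; rewrite Rabs_mult, Rabs_inv, (Rabs_pos_eq b) by lra.
  apply Rmult_le_compat; trivial; [apply Rabs_pos| |].
  - left; apply Rinv_0_lt_compat; lra.
  - now apply Rinv_le_contravar.
Qed.

Lemma kernel_bounded (s t : R) : Rabs s < 1 ->
  Rabs (kernel_re s t) <= 2 / (1 - Rabs s) ^ 2 /\
  Rabs (kernel_im s t) <= 2 / (1 - Rabs s) ^ 2.
Proof.
  intros Hs.
  assert (H0 : 0 < (1 - Rabs s) ^ 2) by (apply pow_lt; lra).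
  pose proof (Rabs_pos s) as Hs0.
  assert (Hc : Rabs (cos t) <= 1) by apply Rabs_le, COS_bound.
  assert (Hsn : Rabs (sin t) <= 1) by apply Rabs_le, SIN_bound.
  split; apply Rabs_div_le; trivial; try now apply kernel_den_ge.
  - apply Rle_trans with (1 := Rabs_triang _ _).
    rewrite Rabs_Ropp, Rabs_R1, Rabs_mult; pose proof (Rabs_pos (cos t)); nra.
  - rewrite Rabs_mult; pose proof (Rabs_pos (sin t)); nra.
Qed.

Lemma kernel_continuous (s phi th : R) : Rabs s < 1 ->
  continuous (fun th => kernel_re s (phi - th)) th /\
  continuous (fun th => kernel_im s (phi - th)) th.
Proof.
  intros Hs; pose proof (kernel_den_pos s (phi - th) Hs) as H.
  unfold kernel_den in H.
  split; apply (ex_derive_continuous (V := R_NormedModule));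
    unfold kernel_re, kernel_im, kernel_den;
    auto_derive; unfold Rminus in *; lra.
Qed.

(** With [z = s rho e^{i phi}], the Cauchy kernel [rho e^{i th} / (rho e^{i th} - z)] equals
    [1 / (1 - s e^{i (phi - th)})]. These are the two hypotheses on the kernel in
    [cauchy_homotopy]. *)
Lemma kernel_cauchy (s phi rho th : R) : Rabs s < 1 ->
  kernel_re s (phi - th) * (rho * cos th - s * rho * cos phi)
    - kernel_im s (phi - th) * (rho * sin th - s * rho * sin phi) = rho * cos th /\
  kernel_re s (phi - th) * (rho * sin th - s * rho * sin phi)
    + kernel_im s (phi - th) * (rho * cos th - s * rho * cos phi) = rho * sin th.
Proof.
  intros Hs; pose proof (kernel_den_pos s (phi - th) Hs) as HN.
  pose proof (sin2_cos2 phi) as E1; pose proof (sin2_cos2 th) as E2.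
  unfold kernel_re, kernel_im.
  set (N := kernel_den s (phi - th)) in *.
  assert (EN : N = kernel_den s (phi - th)) by reflexivity.
  unfold kernel_den in EN; clearbody N.
  rewrite cos_minus in *; rewrite sin_minus; unfold Rsqr in *.
  set (a := cos th) in *; set (b := sin th) in *.
  set (c := cos phi) in *; set (d := sin phi) in *; clearbody a b c d.
  split; apply (Rmult_eq_reg_r N); try lra; field_simplify; try lra;
    apply Rminus_diag_uniq; rewrite EN.
  - transitivity (s ^ 2 * a * rho * (d * d + c * c - 1) + s * c * rho * (b * b + a * a - 1));
      [ring|rewrite E1, E2; ring].
  - transitivity (s ^ 2 * b * rho * (d * d + c * c - 1) + s * d * rho * (b * b + a * a - 1));
      [ring|rewrite E1, E2; ring].
Qed.

(* With [K = 1 / (1 - s e^{it})]: [e^{int} = e^{int} K - s e^{i(n+1)t} K], which makes the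
   geometric expansion of [K] telescope. *)
Lemma kernel_step (s t : R) (n : nat) : Rabs s < 1 ->
  cos (INR n * t) = cos (INR n * t) * kernel_re s t - sin (INR n * t) * kernel_im s t
    - s * (cos (INR (S n) * t) * kernel_re s t - sin (INR (S n) * t) * kernel_im s t) /\
  sin (INR n * t) = cos (INR n * t) * kernel_im s t + sin (INR n * t) * kernel_re s t
    - s * (cos (INR (S n) * t) * kernel_im s t + sin (INR (S n) * t) * kernel_re s t).
Proof.
  intros Hs; pose proof (kernel_den_pos s t Hs) as HN.
  rewrite S_INR, Rmult_plus_distr_r, Rmult_1_l, cos_plus, sin_plus.
  pose proof (sin2_cos2 t) as E1; unfold Rsqr in E1.
  unfold kernel_re, kernel_im.
  set (N := kernel_den s t) in *.
  assert (EN : N = kernel_den s t) by reflexivity.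
  unfold kernel_den in EN; clearbody N.
  set (a := cos t) in *; set (b := sin t) in *.
  set (c := cos (INR n * t)) in *; set (d := sin (INR n * t)) in *; clearbody a b c d.
  split; apply (Rmult_eq_reg_r N); try lra; field_simplify; try lra;
    apply Rminus_diag_uniq; rewrite EN.
  - transitivity (- s ^ 2 * c * (b * b + a * a - 1));
      [ring|rewrite E1; ring].
  - transitivity (- s ^ 2 * d * (b * b + a * a - 1));
      [ring|rewrite E1; ring].
Qed.

Lemma is_lim_seq_geom_scal (C s : R) : Rabs s < 1 ->
  is_lim_seq (fun n => C * s ^ n) 0.
Proof.
  intros Hs; replace (Finite 0) with (Rbar_mult C 0) by (simpl; now rewrite Rmult_0_r).
  now apply is_lim_seq_scal_l, is_lim_seq_geom.
Qed.

Lemma ex_RInt_cont (f : R -> R) (a b : R) :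
  (forall t, continuous f t) -> ex_RInt f a b.
Proof.
  intros H; apply (ex_RInt_continuous (V := R_CompleteNormedModule)); intros t _; apply H.
Qed.

Lemma continuous_Rplus (f g : R -> R) (x : R) :
  continuous f x -> continuous g x -> continuous (fun t => f t + g t) x.
Proof. exact (continuous_plus (V := R_NormedModule) f g x). Qed.

Lemma continuous_Rminus (f g : R -> R) (x : R) :
  continuous f x -> continuous g x -> continuous (fun t => f t - g t) x.
Proof. exact (continuous_minus (V := R_NormedModule) f g x). Qed.

Lemma continuous_Rmult (f g : R -> R) (x : R) :
  continuous f x -> continuous g x -> continuous (fun t => f t * g t) x.
Proof. exact (continuous_mult (K := R_AbsRing) f g x). Qed.

Lemma continuous_cos_lin (a b x : R) : continuous (fun t => cos (a * (b - t))) x.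
Proof.
  apply (ex_derive_continuous (V := R_NormedModule)); auto_derive; trivial.
Qed.

Lemma continuous_sin_lin (a b x : R) : continuous (fun t => sin (a * (b - t))) x.
Proof.
  apply (ex_derive_continuous (V := R_NormedModule)); auto_derive; trivial.
Qed.

Ltac cont :=
  lazymatch goal with
  | |- continuous (fun t => @?f t - @?g t) _ => apply (continuous_Rminus f g); cont
  | |- continuous (fun t => @?f t + @?g t) _ => apply (continuous_Rplus f g); cont
  | |- continuous (fun t => @?f t * @?g t) _ => apply (continuous_Rmult f g); cont
  | |- continuous (fun t => cos _) _ => apply continuous_cos_lin
  | |- continuous (fun t => sin _) _ => apply continuous_sin_lin
  | _ => first [assumption | apply continuous_const]
  end.

Lemma RInt_Rminus (f g : R -> R) (a b : R) :
  (forall t, continuous f t) -> (forall t, continuous g t) ->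
  RInt (fun t => f t - g t) a b = RInt f a b - RInt g a b.
Proof.
  intros Hf Hg.
  exact (RInt_minus (V := R_CompleteNormedModule) f g a b
    (ex_RInt_cont f a b Hf) (ex_RInt_cont g a b Hg)).
Qed.

Lemma RInt_Rscal (f : R -> R) (k a b : R) :
  (forall t, continuous f t) -> RInt (fun t => k * f t) a b = k * RInt f a b.
Proof.
  intros Hf.
  exact (RInt_scal (V := R_CompleteNormedModule) f a b k (ex_RInt_cont f a b Hf)).
Qed.

(** No exchange of sum and integral is needed: by [kernel_step] the partial sums telescope, and the
    remainder is [s^(N+1)] times an integral bounded uniformly in [N]. *)
Lemma kernel_expansion (u v : R -> R) (M s phi : R) :
  Rabs s < 1 -> (forall t, continuous u t) -> (forall t, continuous v t) ->
  (forall t, Rabs (u t) <= M) -> (forall t, Rabs (v t) <= M) ->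
  is_series (fun n => s ^ n *
      RInt (fun t => cos (INR n * (phi - t)) * u t - sin (INR n * (phi - t)) * v t)
        0 (2 * PI))
    (RInt (fun t => kernel_re s (phi - t) * u t - kernel_im s (phi - t) * v t)
      0 (2 * PI)).
Proof.
  intros Hs Hu Hv Bu Bv.
  (* The real part of [e^{i n (phi - t)} K (u + iv)]. *)
  set (E := fun n t =>
    (cos (INR n * (phi - t)) * kernel_re s (phi - t)
      - sin (INR n * (phi - t)) * kernel_im s (phi - t)) * u t
    - (cos (INR n * (phi - t)) * kernel_im s (phi - t)
      + sin (INR n * (phi - t)) * kernel_re s (phi - t)) * v t).
  assert (Hk1 : forall t, continuous (fun t => kernel_re s (phi - t)) t)
    by (intros t; now apply kernel_continuous).
  assert (Hk2 : forall t, continuous (fun t => kernel_im s (phi - t)) t)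
    by (intros t; now apply kernel_continuous).
  assert (HE : forall n t, continuous (E n) t).
  { intros n t; specialize (Hk1 t); specialize (Hk2 t); specialize (Hu t);
      specialize (Hv t); unfold E; cont. }
  assert (Hstep : forall n, s ^ n *
      RInt (fun t => cos (INR n * (phi - t)) * u t - sin (INR n * (phi - t)) * v t)
        0 (2 * PI)
    = s ^ n * RInt (E n) 0 (2 * PI) - s ^ S n * RInt (E (S n)) 0 (2 * PI)).
  { intros n.
    rewrite (RInt_ext _ (fun t => E n t - s * E (S n) t)).
    - rewrite RInt_Rminus, RInt_Rscal; trivial.
      + simpl; real_ring.
      + intros t; apply continuous_Rmult; [apply continuous_const|apply HE].
    - intros t _; destruct (kernel_step s (phi - t) n Hs) as [E1 E2].
      transitivity ((cos (INR n * (phi - t)) * kernel_re s (phi - t)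
            - sin (INR n * (phi - t)) * kernel_im s (phi - t)
            - s * (cos (INR (S n) * (phi - t)) * kernel_re s (phi - t)
              - sin (INR (S n) * (phi - t)) * kernel_im s (phi - t))) * u t
          - (cos (INR n * (phi - t)) * kernel_im s (phi - t)
            + sin (INR n * (phi - t)) * kernel_re s (phi - t)
            - s * (cos (INR (S n) * (phi - t)) * kernel_im s (phi - t)
              + sin (INR (S n) * (phi - t)) * kernel_re s (phi - t))) * v t).
      + now rewrite <- E1, <- E2.
      + unfold E; real_ring. }
  assert (Hsum : forall N, sum_n (fun n => s ^ n *
      RInt (fun t => cos (INR n * (phi - t)) * u t - sin (INR n * (phi - t)) * v t)
        0 (2 * PI)) N
    = RInt (E 0%nat) 0 (2 * PI) - s ^ S N * RInt (E (S N)) 0 (2 * PI)).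
  { induction N as [|N IH].
    - rewrite sum_O, Hstep; simpl; real_ring.
    - rewrite sum_Sn, IH, Hstep; unfold plus; simpl; real_ring. }
  set (K := 2 / (1 - Rabs s) ^ 2).
  assert (HB : forall n, Rabs (RInt (E n) 0 (2 * PI)) <= (2 * PI - 0) * (4 * K * M)).
  { intros n; apply abs_RInt_le_const.
    - pose proof PI_RGT_0; lra.
    - now apply ex_RInt_cont.
    - intros t _; destruct (kernel_bounded s (phi - t) Hs) as [B1 B2].
      fold K in B1, B2; specialize (Bu t); specialize (Bv t).
      assert (Hc : Rabs (cos (INR n * (phi - t))) <= 1) by apply Rabs_le, COS_bound.
      assert (Hsn : Rabs (sin (INR n * (phi - t))) <= 1) by apply Rabs_le, SIN_bound.
      set (c := cos (INR n * (phi - t))) in *; set (d := sin (INR n * (phi - t))) in *.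
      assert (HP : forall x k w, Rabs x <= 1 -> Rabs k <= K -> Rabs w <= M ->
        Rabs (x * k * w) <= K * M).
      { intros x k w Hx Hk Hw; rewrite !Rabs_mult.
        apply Rmult_le_compat; trivial; try apply Rabs_pos.
        - apply Rmult_le_pos; apply Rabs_pos.
        - rewrite <- (Rmult_1_l K); apply Rmult_le_compat; trivial; apply Rabs_pos. }
      unfold E; fold c d.
      replace (_ - _) with (c * kernel_re s (phi - t) * u t
        + - (d * kernel_im s (phi - t) * u t) + - (c * kernel_im s (phi - t) * v t)
        + - (d * kernel_re s (phi - t) * v t)) by ring.
      eapply Rle_trans; [apply Rabs_triang|].
      eapply Rle_trans; [apply Rplus_le_compat_r, Rabs_triang|].
      eapply Rle_trans; [apply Rplus_le_compat_r, Rplus_le_compat_r, Rabs_triang|].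
      rewrite !Rabs_Ropp.
      pose proof (HP c _ _ Hc B1 Bu); pose proof (HP d _ _ Hsn B2 Bu).
      pose proof (HP c _ _ Hc B2 Bv); pose proof (HP d _ _ Hsn B1 Bv); lra. }
  apply (filterlim_ext (fun N =>
    RInt (E 0%nat) 0 (2 * PI) - s ^ S N * RInt (E (S N)) 0 (2 * PI))).
  { intros N; now rewrite Hsum. }
  replace (RInt (fun t => _ * u t - _ * v t) 0 (2 * PI))
    with (RInt (E 0%nat) 0 (2 * PI) - 0).
  2:{ rewrite Rminus_0_r; apply RInt_ext; intros t _; unfold E.
      simpl; rewrite Rmult_0_l, cos_0, sin_0; real_ring. }
  change (is_lim_seq (fun N =>
    RInt (E 0%nat) 0 (2 * PI) - s ^ S N * RInt (E (S N)) 0 (2 * PI))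
    (Finite (RInt (E 0%nat) 0 (2 * PI) - 0))).
  apply is_lim_seq_minus'; [apply is_lim_seq_const|].
  apply is_lim_seq_abs_0.
  apply (is_lim_seq_le_le (fun _ => 0) _
    (fun n => (2 * PI - 0) * (4 * K * M) * Rabs s * Rabs s ^ n)).
  - intros n; split; [apply Rabs_pos|].
    rewrite Rabs_mult, <- RPow_abs.
    rewrite Rmult_assoc, Rmult_comm.
    change (Rabs s * Rabs s ^ n) with (Rabs s ^ S n).
    apply Rmult_le_compat_r; [apply pow_le, Rabs_pos|apply HB].
  - apply is_lim_seq_const.
  - apply is_lim_seq_geom_scal; now rewrite Rabs_Rabsolu.
Qed.

Lemma RInt_cos_lin (k b : R) (n : nat) : (0 < n)%nat -> k = INR n ->
  RInt (fun t => cos (k * (b - t))) 0 (2 * PI) = 0.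
Proof.
  intros Hn ->; assert (H : 0 < INR n) by now apply lt_0_INR.
  apply (RInt_derive_periodic (fun t => - sin (INR n * (b - t)) / INR n)).
  - intros t; auto_derive; trivial; unfold Rminus; field; lra.
  - intros t; apply continuous_cos_lin.
  - f_equal; f_equal.
    replace (INR n * (b - 0)) with (INR n * (b - 2 * PI) + 2 * INR n * PI) by ring.
    now rewrite sin_period.
Qed.

Lemma RInt_sin_lin (k b : R) (n : nat) : k = INR n ->
  RInt (fun t => sin (k * (b - t))) 0 (2 * PI) = 0.
Proof.
  intros ->; destruct n as [|n].
  - rewrite (RInt_ext _ (fun _ => 0)).
    + rewrite RInt_const; apply Rmult_0_r.
    + intros t _; simpl; now rewrite Rmult_0_l, sin_0.
  - assert (H : 0 < INR (S n)) by (apply lt_0_INR; lia).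
    apply (RInt_derive_periodic (fun t => cos (INR (S n) * (b - t)) / INR (S n))).
    + clear - H; set (k := INR (S n)) in *; clearbody k.
      intros t; auto_derive; trivial; unfold Rminus; field; lra.
    + intros t; apply continuous_sin_lin.
    + f_equal.
      replace (INR (S n) * (b - 0)) with (INR (S n) * (b - 2 * PI) + 2 * INR (S n) * PI)
        by ring.
      now rewrite cos_period.
Qed.

Lemma is_series_single (a : nat -> R) (l : R) :
  (forall n, (0 < n)%nat -> a n = 0) -> is_series a l -> l = a 0%nat.
Proof.
  intros H Hl.
  assert (Hs : forall N, sum_n a N = a 0%nat).
  { induction N as [|N IH]; [apply sum_O|].
    rewrite sum_Sn, IH, (H (S N)) by lia; apply Rplus_0_r. }
  assert (E : Finite l = Finite (a 0%nat)).
  { rewrite <- (is_lim_seq_unique (sum_n a) l Hl).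
    rewrite (Lim_seq_ext _ _ Hs); apply Lim_seq_const. }
  now injection E.
Qed.

(** Expanding a constant function with [kernel_expansion], every frequency except [n = 0] integrates
    to zero. *)
Lemma kernel_normalization (s phi u v : R) : Rabs s < 1 ->
  RInt (fun t => kernel_re s (phi - t) * u - kernel_im s (phi - t) * v) 0 (2 * PI)
    = 2 * PI * u.
Proof.
  intros Hs.
  pose proof (kernel_expansion (fun _ => u) (fun _ => v) (Rmax (Rabs u) (Rabs v)) s phi Hs
    (fun t => continuous_const u t) (fun t => continuous_const v t)
    (fun _ => Rmax_l _ _) (fun _ => Rmax_r _ _)) as H.
  assert (Hn : forall n, RInt (fun t => cos (INR n * (phi - t)) * u
      - sin (INR n * (phi - t)) * v) 0 (2 * PI)
    = RInt (fun t => cos (INR n * (phi - t))) 0 (2 * PI) * u).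
  { intros n.
    rewrite (RInt_ext _ (fun t => u * cos (INR n * (phi - t))
      - v * sin (INR n * (phi - t)))) by (intros; real_ring).
    rewrite RInt_Rminus by (intros; cont).
    rewrite !RInt_Rscal by (intros; cont).
    rewrite (RInt_sin_lin _ _ n) by reflexivity; real_ring. }
  apply is_series_single in H.
  - rewrite H, Hn, (RInt_ext _ (fun _ => 1)).
    + rewrite RInt_const; unfold scal; simpl; unfold mult; simpl; ring.
    + intros t _; simpl; now rewrite Rmult_0_l, cos_0.
  - intros n Hpos; rewrite Hn, (RInt_cos_lin _ _ n) by trivial; ring.
Qed.

(* Real part of the [n]-th Taylor coefficient of [U + iV], as an integral over the
   circle of radius [rho]; the imaginary part is that of [V - iU = -i (U + iV)]. *)
Definition taylor_re (U V : R -> R -> R) (rho : R) (n : nat) : R :=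
  / rho ^ n * (/ (2 * PI) *
    RInt (fun t => cos (INR n * t) * U (rho * cos t) (rho * sin t)
      + sin (INR n * t) * V (rho * cos t) (rho * sin t)) 0 (2 * PI)).

Definition taylor_im (U V : R -> R -> R) (rho : R) (n : nat) : R :=
  taylor_re V (fun x y => - U x y) rho n.

Lemma circle_in_disc (rho t : R) : Rabs rho < 1 ->
  (rho * cos t) ^ 2 + (rho * sin t) ^ 2 < 1.
Proof.
  intros H; replace (_ + _) with (rho ^ 2 * ((sin t)² + (cos t)²)) by (unfold Rsqr; ring).
  rewrite sin2_cos2, <- (pow2_abs rho); pose proof (Rabs_pos rho); nra.
Qed.

Lemma cauchy_riemann_circle_continuous (U V p q : R -> R -> R) (rho t : R) :
  cauchy_riemann U V p q -> Rabs rho < 1 ->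
  continuous (fun t => U (rho * cos t) (rho * sin t)) t /\
  continuous (fun t => V (rho * cos t) (rho * sin t)) t.
Proof.
  intros HF Hrho.
  destruct (cauchy_riemann_differentiable U V p q _ _ HF (circle_in_disc rho t Hrho))
    as [HU HV].
  assert (HX : is_derive (fun t => rho * cos t) t (- rho * sin t))
    by (auto_derive; trivial; ring).
  assert (HY : is_derive (fun t => rho * sin t) t (rho * cos t))
    by (auto_derive; trivial; ring).
  split; apply (ex_derive_continuous (V := R_NormedModule)); eexists.
  - exact (is_derive_comp_2d U _ _ t _ _ _ _ HU HX HY).
  - exact (is_derive_comp_2d V _ _ t _ _ _ _ HV HX HY).
Qed.

Lemma continuous_cos_scal (a x : R) : continuous (fun t => cos (a * t)) x.
Proof. apply (ex_derive_continuous (V := R_NormedModule)); auto_derive; trivial. Qed.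

Lemma continuous_sin_scal (a x : R) : continuous (fun t => sin (a * t)) x.
Proof. apply (ex_derive_continuous (V := R_NormedModule)); auto_derive; trivial. Qed.

(** Cauchy's estimate; the factor 2 comes from bounding the two terms of the integrand separately.
    Only uniformity in [n] matters later. *)
Lemma taylor_re_bounded (U V p q : R -> R -> R) (M rho : R) (n : nat) :
  cauchy_riemann U V p q -> 0 < rho < 1 ->
  (forall x y, x ^ 2 + y ^ 2 < 1 -> Rabs (U x y) <= M /\ Rabs (V x y) <= M) ->
  rho ^ n * Rabs (taylor_re U V rho n) <= 2 * M.
Proof.
  intros HF Hrho HM.
  assert (Hr : Rabs rho < 1) by (rewrite Rabs_pos_eq; lra).
  pose proof PI_RGT_0 as Hpi; pose proof (pow_lt rho n (proj1 Hrho)) as Hn.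
  unfold taylor_re; rewrite Rabs_mult, Rabs_inv, (Rabs_pos_eq (rho ^ n)) by lra.
  rewrite <- Rmult_assoc, Rinv_r, Rmult_1_l, Rabs_mult, Rabs_inv by lra.
  rewrite (Rabs_pos_eq (2 * PI)) by lra.
  apply (Rmult_le_reg_l (2 * PI)); [lra|].
  rewrite <- Rmult_assoc, Rinv_r, Rmult_1_l by lra.
  replace (2 * PI * (2 * M)) with ((2 * PI - 0) * (2 * M)) by ring.
  apply abs_RInt_le_const; [lra| |].
  - apply ex_RInt_cont; intros t.
    destruct (cauchy_riemann_circle_continuous U V p q rho t HF Hr).
    apply continuous_Rplus; apply continuous_Rmult; trivial;
      [apply continuous_cos_scal | apply continuous_sin_scal].
  - intros t _; destruct (HM _ _ (circle_in_disc rho t Hr)) as [B1 B2].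
    apply Rle_trans with (1 := Rabs_triang _ _); rewrite !Rabs_mult.
    assert (Hc : Rabs (cos (INR n * t)) <= 1) by apply Rabs_le, COS_bound.
    assert (Hs : Rabs (sin (INR n * t)) <= 1) by apply Rabs_le, SIN_bound.
    pose proof (Rabs_pos (U (rho * cos t) (rho * sin t))).
    pose proof (Rabs_pos (V (rho * cos t) (rho * sin t))).
    nra.
Qed.

(** One integral is evaluated twice: [kernel_expansion] with [s = r / rho] turns it into the series,
    while [cauchy_homotopy] and [kernel_normalization] reduce it to the value at [r e^{i phi}].
    Negative [r] is allowed, so that [phi = 0] covers a full interval of the real axis. *)
Lemma cauchy_riemann_series (U V p q : R -> R -> R) (M rho r phi : R) :
  cauchy_riemann U V p q -> 0 < rho < 1 -> Rabs r < rho ->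
  (forall x y, x ^ 2 + y ^ 2 < 1 -> Rabs (U x y) <= M /\ Rabs (V x y) <= M) ->
  is_series (fun n => r ^ n * (taylor_re U V rho n * cos (INR n * phi)
      - taylor_im U V rho n * sin (INR n * phi)))
    (U (r * cos phi) (r * sin phi)).
Proof.
  intros HF Hrho Hr HM.
  assert (Hrho1 : Rabs rho < 1) by (rewrite Rabs_pos_eq; lra).
  set (s := r / rho).
  assert (Er : r = s * rho) by (unfold s; field; lra).
  assert (Hs : Rabs s < 1).
  { unfold s, Rdiv; rewrite Rabs_mult, Rabs_inv, (Rabs_pos_eq rho) by lra.
    apply (Rmult_lt_reg_r rho); [lra|].
    rewrite Rmult_assoc, Rinv_l by lra; lra. }
  set (u := fun t => U (rho * cos t) (rho * sin t)).
  set (v := fun t => V (rho * cos t) (rho * sin t)).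
  assert (Hu : forall t, continuous u t)
    by (intros t; now apply (cauchy_riemann_circle_continuous U V p q)).
  assert (Hv : forall t, continuous v t)
    by (intros t; now apply (cauchy_riemann_circle_continuous U V p q)).
  assert (Bu : forall t, Rabs (u t) <= M) by (intros t; now apply HM, circle_in_disc).
  assert (Bv : forall t, Rabs (v t) <= M) by (intros t; now apply HM, circle_in_disc).
  pose proof (kernel_expansion u v M s phi Hs Hu Hv Bu Bv) as HS.
  change (fun t => kernel_re s (phi - t) * u t - kernel_im s (phi - t) * v t)
    with (fun t => kernel_re s (phi - t) * U (rho * cos t) (rho * sin t)
      - kernel_im s (phi - t) * V (rho * cos t) (rho * sin t)) in HS.
  rewrite (cauchy_homotopy U V p q r phi rho (fun t => kernel_re s (phi - t))
    (fun t => kernel_im s (phi - t))) in HS; trivial;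
    try (intros t; now apply kernel_continuous);
    try (intros t; rewrite Er; now apply kernel_cauchy); try lra.
  rewrite kernel_normalization in HS by trivial.
  pose proof PI_RGT_0 as Hpi.
  apply (is_series_scal_l (/ (2 * PI))) in HS.
  replace (U (r * cos phi) (r * sin phi))
    with (mult (/ (2 * PI)) (2 * PI * U (r * cos phi) (r * sin phi))).
  2:{ unfold mult; simpl; field; lra. }
  eapply is_series_ext; [|exact HS]; intros n.
  change (/ (2 * PI) * (s ^ n * RInt (fun t => cos (INR n * (phi - t)) * u t -
      sin (INR n * (phi - t)) * v t) 0 (2 * PI)) =
    r ^ n * (/ rho ^ n * (/ (2 * PI) * RInt (fun t => cos (INR n * t) * u t
        + sin (INR n * t) * v t) 0 (2 * PI)) * cos (INR n * phi)
      - / rho ^ n * (/ (2 * PI) * RInt (fun t => cos (INR n * t) * v t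
        + sin (INR n * t) * - u t) 0 (2 * PI)) * sin (INR n * phi))).
  rewrite (RInt_ext (fun t => cos (INR n * (phi - t)) * u t -
      sin (INR n * (phi - t)) * v t)
    (fun t => cos (INR n * phi) * (cos (INR n * t) * u t + sin (INR n * t) * v t)
      - sin (INR n * phi) * (cos (INR n * t) * v t + sin (INR n * t) * - u t))).
  2:{ intros t _; rewrite Rmult_minus_distr_l, cos_minus, sin_minus; real_ring. }
  assert (C1 : forall t, continuous (fun t => cos (INR n * t) * u t
      + sin (INR n * t) * v t) t).
  { intros t; apply continuous_Rplus; apply continuous_Rmult; trivial;
      [apply continuous_cos_scal | apply continuous_sin_scal]. }
  assert (C2 : forall t, continuous (fun t => cos (INR n * t) * v t
      + sin (INR n * t) * - u t) t).
  { intros t; apply continuous_Rplus; apply continuous_Rmult; trivial;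
      [apply continuous_cos_scal | apply continuous_sin_scal|].
    now apply (continuous_opp (V := R_NormedModule)). }
  rewrite RInt_Rminus.
  2,3: intros t; apply continuous_Rmult; trivial; apply continuous_const.
  rewrite !RInt_Rscal by trivial.
  rewrite Er, Rpow_mult_distr.
  assert (rho ^ n <> 0) by (apply pow_nonzero; lra).
  field; lra.
Qed.

(** * Quaternions and slices *)

Definition qdot (p q : quat) : R :=
  let '(p0, p1, p2, p3) := p in
  let '(q0, q1, q2, q3) := q in p0 * q0 + p1 * q1 + p2 * q2 + p3 * q3.

Definition qconj (p : quat) : quat :=
  let '(p0, p1, p2, p3) := p in (p0, - p1, - p2, - p3).

Ltac quat_destruct :=
  repeat match goal with q : quat |- _ => destruct q as [[[? ?] ?] ?] end.

Ltac quat_ring :=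
  intros; quat_destruct;
  unfold slice_point, qsub, qopp, qadd, qmul, qconj, qdot, quat_of_R;
  repeat match goal with |- (_, _) = (_, _) => f_equal end;
  real_ring.

Lemma qnorm_sqr (q : quat) : qnorm q ^ 2 = qdot q q.
Proof.
  destruct q as [[[a b] c] d]; unfold qnorm, qdot.
  rewrite pow2_sqrt; [ring|].
  pose proof (pow2_ge_0 a); pose proof (pow2_ge_0 b); pose proof (pow2_ge_0 c);
    pose proof (pow2_ge_0 d); lra.
Qed.

Lemma qnorm_ge0 (q : quat) : 0 <= qnorm q.
Proof. destruct q as [[[a b] c] d]; apply sqrt_pos. Qed.

Lemma qdot_sqr_ge0 (q : quat) : 0 <= qdot q q.
Proof. rewrite <- qnorm_sqr; apply pow2_ge_0. Qed.

Lemma qnorm_0 : qnorm 0 = 0.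
Proof. unfold qnorm, quat_of_R; replace (_ + _ + _ + _) with 0 by ring; apply sqrt_0. Qed.

Lemma qnorm_le (q : quat) (r : R) : 0 <= r -> qdot q q <= r ^ 2 <-> qnorm q <= r.
Proof.
  intros Hr; rewrite <- qnorm_sqr; pose proof (qnorm_ge0 q) as Hq; split; intros H.
  - apply Rsqr_incr_0_var; unfold Rsqr; lra.
  - now apply pow_incr.
Qed.

Lemma unit_ball_dot (q : quat) : unit_ball q <-> qdot q q < 1.
Proof.
  unfold unit_ball; rewrite <- qnorm_sqr; pose proof (qnorm_ge0 q) as Hq.
  split; intros H; nra.
Qed.

Lemma qdot_mul (p q : quat) : qdot (p * q)%quat (p * q)%quat = qdot p p * qdot q q.
Proof. revert p q; quat_ring. Qed.

Lemma qdot_conj (q : quat) : qdot (qconj q) (qconj q) = qdot q q.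
Proof. revert q; quat_ring. Qed.

Lemma qnorm_mul (p q : quat) : qnorm (p * q)%quat = qnorm p * qnorm q.
Proof.
  apply Rsqr_inj; try apply Rmult_le_pos; try apply qnorm_ge0.
  rewrite Rsqr_mult, !Rsqr_pow2, !qnorm_sqr; apply qdot_mul.
Qed.

(** [qdot p q] is the real part of [conj(p) q], whose squared norm is the right-hand side; the
    difference is the squared norm of the imaginary part. *)
Lemma cauchy_schwarz (p q : quat) : qdot p q ^ 2 <= qdot p p * qdot q q.
Proof.
  replace (qdot p p * qdot q q) with (qdot p q ^ 2
    + (let '(_, v1, v2, v3) := (qconj p * q)%quat in v1 ^ 2 + v2 ^ 2 + v3 ^ 2)).
  - destruct (qconj p * q)%quat as [[[a b] c] d].
    pose proof (pow2_ge_0 b); pose proof (pow2_ge_0 c); pose proof (pow2_ge_0 d); lra.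
  - revert p q; quat_ring.
Qed.

Lemma Rabs_qdot_le (p q : quat) : Rabs (qdot p q) <= qnorm p * qnorm q.
Proof.
  apply Rabs_le_between, Rabs_le_between.
  rewrite <- (Rabs_pos_eq (qnorm p * qnorm q))
    by (apply Rmult_le_pos; apply qnorm_ge0).
  apply Rsqr_le_abs_0; rewrite Rsqr_mult, !Rsqr_pow2, !qnorm_sqr.
  apply cauchy_schwarz.
Qed.

Lemma imag_unit_spec (I : quat) : imag_unit I ->
  exists i1 i2 i3, I = (0, i1, i2, i3) /\ i1 ^ 2 + i2 ^ 2 + i3 ^ 2 = 1.
Proof.
  destruct I as [[[a b] c] d]; unfold imag_unit, qmul, qopp, quat_of_R; intros H.
  injection H as H0 H1 H2 H3.
  assert (Ha : a = 0).
  { destruct (Req_dec a 0) as [|Ha]; trivial; exfalso.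
    assert (Hb : b = 0) by (apply (Rmult_eq_reg_l a); lra).
    assert (Hc : c = 0) by (apply (Rmult_eq_reg_l a); lra).
    assert (Hd : d = 0) by (apply (Rmult_eq_reg_l a); lra).
    subst; pose proof (Rle_0_sqr a); unfold Rsqr in *; lra. }
  subst a; exists b, c, d; split; [reflexivity|lra].
Qed.

Lemma imag_unit_intro (i1 i2 i3 : R) : i1 ^ 2 + i2 ^ 2 + i3 ^ 2 = 1 ->
  imag_unit (0, i1, i2, i3).
Proof.
  intros H; unfold imag_unit, qmul, qopp, quat_of_R.
  repeat f_equal; lra.
Qed.

Lemma qdot_slice_point (I : quat) (x y : R) : imag_unit I ->
  qdot (slice_point I x y) (slice_point I x y) = x ^ 2 + y ^ 2.
Proof.
  intros HI; destruct (imag_unit_spec I HI) as (i1 & i2 & i3 & -> & E).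
  replace (y ^ 2) with (y ^ 2 * (i1 ^ 2 + i2 ^ 2 + i3 ^ 2)) by (rewrite E; ring).
  clear; quat_ring.
Qed.

Lemma slice_point_unit_ball (I : quat) (x y : R) : imag_unit I ->
  x ^ 2 + y ^ 2 < 1 <-> unit_ball (slice_point I x y).
Proof. intros HI; now rewrite unit_ball_dot, qdot_slice_point. Qed.

Lemma qdot_imag_skew (I e q : quat) : imag_unit I ->
  qdot (I * e)%quat q = - qdot e (I * q)%quat.
Proof.
  intros HI; destruct (imag_unit_spec I HI) as (i1 & i2 & i3 & -> & _); quat_ring.
Qed.

Lemma qmul_assoc (p q r : quat) : (p * (q * r) = p * q * r)%quat.
Proof. revert p q r; quat_ring. Qed.

Lemma imag_unit_mul2 (I q : quat) : imag_unit I -> (I * (I * q) = - q)%quat.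
Proof. intros HI; rewrite qmul_assoc, HI; quat_ring. Qed.

Lemma qnorm_imag_unit (I : quat) : imag_unit I -> qnorm I = 1.
Proof.
  intros HI; destruct (imag_unit_spec I HI) as (i1 & i2 & i3 & -> & E).
  unfold qnorm; replace (_ + _ + _ + _) with 1 by (rewrite <- E; ring); apply sqrt_1.
Qed.

Lemma is_derive_linear {V W : NormedModule R_AbsRing} (l : V -> W) (f : R -> V)
  (x : R) (d : V) : is_linear l -> is_derive f x d ->
  is_derive (fun t => l (f t)) x (l d).
Proof.
  intros Hl Hf; unfold is_derive.
  apply (filterdiff_ext_lin _ (fun y : R => l (scal (y : R_AbsRing) d))).
  - apply (filterdiff_comp' f l); [exact Hf|now apply filterdiff_linear].
  - intros y; now apply linear_scal.
Qed.

Lemma is_derive_qdot (e : quat) (f : R -> quat) (x : R) (d : quat) :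
  is_derive f x d -> is_derive (fun t => qdot e (f t)) x (qdot e d).
Proof.
  intros H.
  pose proof (is_derive_linear fst f x d is_linear_fst H) as H1.
  pose proof (is_derive_linear fst _ x _ is_linear_fst H1) as H2.
  destruct e as [[[e0 e1] e2] e3].
  pose proof (is_derive_scal _ _ e0 _ (is_derive_linear fst _ x _ is_linear_fst H2)) as G0.
  pose proof (is_derive_scal _ _ e1 _ (is_derive_linear snd _ x _ is_linear_snd H2)) as G1.
  pose proof (is_derive_scal _ _ e2 _ (is_derive_linear snd _ x _ is_linear_snd H1)) as G2.
  pose proof (is_derive_scal _ _ e3 _ (is_derive_linear snd f x d is_linear_snd H)) as G3.
  pose proof (is_derive_plus _ _ _ _ _ (is_derive_plus _ _ _ _ _
    (is_derive_plus _ _ _ _ _ G0 G1) G2) G3) as G.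
  destruct d as [[[d0 d1] d2] d3]; revert G; apply is_derive_ext.
  intros t; now destruct (f t) as [[[a b] c] g].
Qed.

Lemma continuity_2d_pt_qdot (e : quat) (f : R * R -> quat) (x y : R) :
  continuous f (x, y) -> continuity_2d_pt (fun u v => qdot e (f (u, v))) x y.
Proof.
  intros H.
  pose proof (continuous_comp f fst (x, y) H (continuous_fst _ _)) as H1.
  pose proof (continuous_comp _ fst (x, y) H1 (continuous_fst _ _)) as H2.
  pose proof (continuous_comp _ fst (x, y) H2 (continuous_fst _ _)) as C0.
  pose proof (continuous_comp _ snd (x, y) H2 (continuous_snd _ _)) as C1.
  pose proof (continuous_comp _ snd (x, y) H1 (continuous_snd _ _)) as C2.
  pose proof (continuous_comp f snd (x, y) H (continuous_snd _ _)) as C3.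
  destruct e as [[[e0 e1] e2] e3].
  apply (continuity_2d_pt_ext (fun u v => e0 * fst (fst (fst (f (u, v))))
    + e1 * snd (fst (fst (f (u, v)))) + e2 * snd (fst (f (u, v))) + e3 * snd (f (u, v)))).
  - intros u v; now destruct (f (u, v)) as [[[a b] c] g].
  - assert (Hc : forall g : R * R -> R, continuous g (x, y) ->
      continuity_2d_pt (fun u v => g (u, v)) x y).
    { intros g Hg; apply continuity_2d_pt_filterlim.
      apply (continuous_ext g (fun z => g (fst z, snd z)) (x, y)); [now intros [u v]|exact Hg]. }
    apply (Hc _) in C0; apply (Hc _) in C1; apply (Hc _) in C2; apply (Hc _) in C3.
    repeat apply continuity_2d_pt_plus; apply continuity_2d_pt_mult; trivial;
      apply continuity_2d_pt_const.
Qed.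

(* For every [e], [<e, f> + i <I e, f>] is holomorphic on the slice of [I], so no
   splitting of the quaternions along [I] is needed. *)
Lemma slice_regular_cauchy_riemann (f : quat -> quat) (I : quat) :
  slice_regular f -> imag_unit I ->
  exists fx : R * R -> quat,
    (forall x y, x ^ 2 + y ^ 2 < 1 -> is_partial_x f I x y (fx (x, y))) /\
    (forall x y, x ^ 2 + y ^ 2 < 1 -> is_partial_y f I x y (I * fx (x, y))%quat) /\
    forall e, cauchy_riemann (fun x y => qdot e (f (slice_point I x y)))
      (fun x y => qdot (I * e)%quat (f (slice_point I x y)))
      (fun x y => qdot e (fx (x, y))) (fun x y => qdot (I * e)%quat (fx (x, y))).
Proof.
  intros Hf HI; destruct (Hf I HI) as (fx & fy & H); exists fx.
  assert (Efy : forall x y, x ^ 2 + y ^ 2 < 1 -> fy (x, y) = (I * fx (x, y))%quat).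
  { intros x y Hxy.
    destruct (H x y (proj1 (slice_point_unit_ball I x y HI) Hxy)) as (_ & _ & _ & _ & E).
    assert (E' : (fx (x, y) + I * fy (x, y) = 0)%quat).
    { revert E; generalize (fx (x, y) + I * fy (x, y))%quat.
      intros [[[a b] c] d] E; unfold qmul, quat_of_R in *.
      injection E as E0 E1 E2 E3; repeat f_equal; lra. }
    (* Multiplying the slice equation by [I] solves it for [fy], since [I * I = -1]. *)
    assert (E'' : (I * fx (x, y) + I * (I * fy (x, y)) = 0)%quat).
    { transitivity (I * (fx (x, y) + I * fy (x, y)))%quat;
        [|rewrite E'; clear; quat_ring].
      generalize (I * fy (x, y))%quat; generalize (fx (x, y)) I; clear; quat_ring. }
    rewrite (imag_unit_mul2 I _ HI) in E''.
    revert E''; generalize (I * fx (x, y))%quat (fy (x, y)); clear.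
    intros [[[a b] c] d] [[[a' b'] c'] d'] E; unfold qadd, qopp, quat_of_R in *.
    injection E as E0 E1 E2 E3; repeat f_equal; lra. }
  assert (Hx : forall x y, x ^ 2 + y ^ 2 < 1 -> is_partial_x f I x y (fx (x, y)))
    by (intros x y Hxy; now apply H, slice_point_unit_ball).
  assert (Hy : forall x y, x ^ 2 + y ^ 2 < 1 ->
    is_partial_y f I x y (I * fx (x, y))%quat).
  { intros x y Hxy; rewrite <- Efy by trivial; now apply H, slice_point_unit_ball. }
  split; [exact Hx|split; [exact Hy|]]; intros e x y Hxy.
  destruct (H x y (proj1 (slice_point_unit_ball I x y HI) Hxy)) as (_ & _ & Hc & _).
  split; [split|split; [split|split]].
  - exact (is_derive_qdot e _ x _ (Hx x y Hxy)).
  - rewrite (qdot_imag_skew I e _ HI), Ropp_involutive.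
    exact (is_derive_qdot e _ y _ (Hy x y Hxy)).
  - exact (is_derive_qdot (I * e)%quat _ x _ (Hx x y Hxy)).
  - pose proof (is_derive_qdot (I * e)%quat _ y _ (Hy x y Hxy)) as D.
    rewrite (qdot_imag_skew I e _ HI), imag_unit_mul2 in D by trivial.
    replace (qdot e (fx (x, y))) with (- qdot e (- fx (x, y))%quat); [exact D|].
    generalize (fx (x, y)) e; clear; quat_ring.
  - now apply continuity_2d_pt_qdot.
  - now apply continuity_2d_pt_qdot.
Qed.

(** * Real power series near the origin, and the common expansion on all slices *)

Lemma power_series_PSeries (c : nat -> R) (h : R -> R) (d : R) : 0 < d ->
  (forall r, Rabs r < d -> is_series (fun n => r ^ n * c n) (h r)) ->
  Rbar_lt 0 (CV_radius c) /\ forall r, Rabs r < d -> PSeries c r = h r.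
Proof.
  intros Hd Hc.
  assert (Hc' : forall r, Rabs r < d -> is_pseries c r (h r)).
  { intros r Hr; apply is_pseries_R.
    apply (is_series_ext (fun n => r ^ n * c n)); [intros k; apply Rmult_comm|].
    now apply Hc. }
  split; [|intros r Hr; now apply is_pseries_unique, Hc'].
  apply Rbar_not_le_lt; intros Hle.
  assert (Hd2 : Rabs (d / 2) < d) by (rewrite Rabs_pos_eq; lra).
  apply (CV_disk_outside c (d / 2)).
  - apply Rbar_le_lt_trans with (1 := Hle); simpl; rewrite Rabs_pos_eq; lra.
  - apply ex_series_lim_0; exists (h (d / 2)); apply is_pseries_R, Hc', Hd2.
Qed.

Lemma locally_0_Rabs (d : R) (P : R -> Prop) : 0 < d ->
  (forall r, Rabs r < d -> P r) -> locally 0 P.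
Proof.
  intros Hd H; exists (mkposreal d Hd); intros r Hr; apply H.
  replace r with (minus r 0) by (unfold minus, plus, opp; simpl; ring); exact Hr.
Qed.

Lemma power_series_unique (a b : nat -> R) (h : R -> R) (d : R) : 0 < d ->
  (forall r, Rabs r < d -> is_series (fun n => r ^ n * a n) (h r)) ->
  (forall r, Rabs r < d -> is_series (fun n => r ^ n * b n) (h r)) ->
  forall n, a n = b n.
Proof.
  intros Hd Ha Hb n.
  destruct (power_series_PSeries a h d Hd Ha) as [Ra Ea].
  destruct (power_series_PSeries b h d Hd Hb) as [Rb Eb].
  apply PSeries_ext_recip; trivial.
  apply (locally_0_Rabs d); [exact Hd|]; intros r Hr; now rewrite Ea, Eb.
Qed.

Lemma power_series_derive_0 (c : nat -> R) (h : R -> R) (d : R) : 0 < d ->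
  (forall r, Rabs r < d -> is_series (fun n => r ^ n * c n) (h r)) ->
  is_derive h 0 (c 1%nat).
Proof.
  intros Hd Hc; destruct (power_series_PSeries c h d Hd Hc) as [Rc Ec].
  apply (is_derive_ext_loc (PSeries c)).
  - apply (locally_0_Rabs d); [exact Hd|exact Ec].
  - replace (c 1%nat) with (PSeries (PS_derive c) 0).
    + apply is_derive_PSeries; now rewrite Rabs_R0.
    + rewrite PSeries_0; unfold PS_derive; simpl; ring.
Qed.

Lemma le_left_limit (g : R -> R) (B : R) :
  continuous g 1 -> (forall r, 0 < r < 1 -> g r <= B) -> g 1 <= B.
Proof.
  intros Hc H; apply Rnot_lt_le; intros Hlt.
  destruct (Hc (fun z => B < z) (open_gt B _ Hlt)) as [d Hd].
  set (m := Rmin (d / 2) (1 / 2)).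
  assert (Hm : 0 < m) by (apply Rmin_pos; [apply is_pos_div_2|lra]).
  assert (Hm1 : m <= d / 2) by apply Rmin_l.
  assert (Hm2 : m <= 1 / 2) by apply Rmin_r.
  assert (Hbr : B < g (1 - m)).
  { apply Hd; change (Rabs (1 - m - 1) < d).
    replace (1 - m - 1) with (- m) by ring.
    rewrite Rabs_Ropp, Rabs_pos_eq by lra; pose proof (cond_pos d); lra. }
  assert (H1 : 0 < 1 - m < 1) by lra.
  specialize (H (1 - m) H1); lra.
Qed.

Lemma qdot_linear (e q : quat) : qdot e q =
  let '(e0, e1, e2, e3) := e in
  e0 * qdot (1, 0, 0, 0) q + e1 * qdot (0, 1, 0, 0) q
  + e2 * qdot (0, 0, 1, 0) q + e3 * qdot (0, 0, 0, 1) q.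
Proof. quat_ring. Qed.

(** The coefficients [A e I rho] are integrals over one circle in one slice. For [phi = 0] the sine
    terms drop out and each of these sequences expands the same function [qdot e (h r)] of a real
    variable, so uniqueness makes them independent of [I] and [rho]. It also shows linearity in [e],
    hence a single quaternion [a n] represents them all. *)
Lemma slice_regular_power_series (f : quat -> quat) :
  slice_regular f -> (forall q, unit_ball q -> unit_ball (f q)) ->
  exists a : nat -> quat, (forall n, qnorm (a n) <= 2) /\
  forall e I r phi, imag_unit I -> Rabs r < 1 ->
  is_series (fun n => r ^ n *
      qdot e (slice_point I (cos (INR n * phi)) (sin (INR n * phi)) * a n)%quat)
    (qdot e (f (slice_point I (r * cos phi) (r * sin phi)))).
Proof.
  intros Hf Hball.
  set (A := fun e I rho => taylor_re (fun x y => qdot e (f (slice_point I x y)))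
    (fun x y => qdot (I * e)%quat (f (slice_point I x y))) rho).
  assert (HB : forall e I, imag_unit I -> forall x y, x ^ 2 + y ^ 2 < 1 ->
    Rabs (qdot e (f (slice_point I x y))) <= qnorm e /\
    Rabs (qdot (I * e)%quat (f (slice_point I x y))) <= qnorm e).
  { intros e I HI x y Hxy.
    pose proof (Hball _ (proj1 (slice_point_unit_ball I x y HI) Hxy)) as Hb.
    unfold unit_ball in Hb.
    pose proof (qnorm_ge0 e) as He.
    split; apply Rle_trans with (1 := Rabs_qdot_le _ _);
      rewrite ?qnorm_mul, ?(qnorm_imag_unit I HI); nra. }
  assert (HS : forall e I rho r phi, imag_unit I -> 0 < rho < 1 -> Rabs r < rho ->
    is_series (fun n => r ^ n * (A e I rho n * cos (INR n * phi)
      - A (I * e)%quat I rho n * sin (INR n * phi)))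
    (qdot e (f (slice_point I (r * cos phi) (r * sin phi))))).
  { intros e I rho r phi HI Hrho Hr.
    destruct (slice_regular_cauchy_riemann f I Hf HI) as (fx & _ & _ & HCR).
    pose proof (cauchy_riemann_series _ _ _ _ (qnorm e) rho r phi (HCR e) Hrho Hr
      (HB e I HI)) as H.
    revert H; apply is_series_ext; intros n.
    (* [taylor_im] for [e] is [taylor_re] for [I * e], because [I * (I * e) = - e]. *)
    do 3 f_equal; unfold A, taylor_im, taylor_re.
    do 2 f_equal; apply RInt_ext; intros t _.
    rewrite (imag_unit_mul2 I e HI); do 2 f_equal.
    generalize (f (slice_point I (rho * cos t) (rho * sin t))) e; clear; quat_ring. }
  set (h := fun r : R => f (r, 0, 0, 0)).
  assert (Hreal : forall I r, slice_point I (r * cos 0) (r * sin 0) = (r, 0, 0, 0)).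
  { intros I r; rewrite cos_0, sin_0; quat_ring. }
  assert (HS0 : forall e I rho r, imag_unit I -> 0 < rho < 1 -> Rabs r < rho ->
    is_series (fun n => r ^ n * A e I rho n) (qdot e (h r))).
  { intros e I rho r HI Hrho Hr; pose proof (HS e I rho r 0 HI Hrho Hr) as H.
    rewrite Hreal in H; revert H; apply is_series_ext; intros n.
    rewrite Rmult_0_r, cos_0, sin_0; real_ring. }
  assert (Hi : imag_unit (0, 1, 0, 0)) by (apply imag_unit_intro; ring).
  (* The unit [i] and the radius [1 / 2] are an arbitrary reference choice. *)
  set (A0 := fun e => A e (0, 1, 0, 0) (1 / 2)).
  set (a := fun n => (A0 (1, 0, 0, 0) n, A0 (0, 1, 0, 0) n, A0 (0, 0, 1, 0) n,
    A0 (0, 0, 0, 1) n) : quat).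
  assert (HA : forall e I rho n, imag_unit I -> 0 < rho < 1 -> A e I rho n = qdot e (a n)).
  { intros e I rho n HI Hrho; revert n.
    assert (Hm : 0 < Rmin rho (1 / 2)) by (apply Rmin_pos; lra).
    apply (power_series_unique _ _ (fun r => qdot e (h r)) (Rmin rho (1 / 2)) Hm).
    - intros r Hr; apply HS0; trivial.
      apply Rlt_le_trans with (1 := Hr), Rmin_l.
    - intros r Hr.
      assert (Hr2 : Rabs r < 1 / 2) by (apply Rlt_le_trans with (1 := Hr), Rmin_r).
      assert (H12 : 0 < 1 / 2 < 1) by lra.
      rewrite (qdot_linear e (h r)).
      destruct e as [[[e0 e1] e2] e3].
      pose proof (is_series_scal_l e0 _ _ (HS0 (1, 0, 0, 0) _ _ r Hi H12 Hr2)) as S0.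
      pose proof (is_series_scal_l e1 _ _ (HS0 (0, 1, 0, 0) _ _ r Hi H12 Hr2)) as S1.
      pose proof (is_series_scal_l e2 _ _ (HS0 (0, 0, 1, 0) _ _ r Hi H12 Hr2)) as S2.
      pose proof (is_series_scal_l e3 _ _ (HS0 (0, 0, 0, 1) _ _ r Hi H12 Hr2)) as S3.
      pose proof (is_series_plus _ _ _ _ (is_series_plus _ _ _ _
        (is_series_plus _ _ _ _ S0 S1) S2) S3) as S.
      revert S; apply is_series_ext; intros n.
      unfold a; change (A ?e _ (1 / 2) n) with (A0 e n).
      generalize (A0 (1, 0, 0, 0) n) (A0 (0, 1, 0, 0) n) (A0 (0, 0, 1, 0) n)
        (A0 (0, 0, 0, 1) n) (r ^ n); clear; intros.
      unfold qdot, plus, scal, mult; simpl; unfold mult; simpl; real_ring. }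
  exists a; split.
  - intros n; apply qnorm_le; [lra|].
    (* Cauchy's estimate tested against [e = a n]: as [rho] tends to 1 it becomes
       [|a_n|^2 <= 2 |a_n|]. *)
    assert (Hb : forall rho, 0 < rho < 1 -> rho ^ n * qdot (a n) (a n) <= 2 * qnorm (a n)).
    { intros rho Hrho; rewrite <- (HA (a n) (0, 1, 0, 0) rho n Hi Hrho).
      destruct (slice_regular_cauchy_riemann f _ Hf Hi) as (fx & _ & _ & HCR).
      pose proof (taylor_re_bounded _ _ _ _ (qnorm (a n)) rho n (HCR (a n)) Hrho
        (HB (a n) _ Hi)) as H.
      apply Rle_trans with (2 := H), Rmult_le_compat_l; [apply pow_le; lra|].
      apply Rle_abs. }
    assert (Hl : 1 ^ n * qdot (a n) (a n) <= 2 * qnorm (a n)).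
    { apply (le_left_limit (fun rho => rho ^ n * qdot (a n) (a n))); [|exact Hb].
      apply (ex_derive_continuous (V := R_NormedModule)); auto_derive; trivial. }
    rewrite pow1, Rmult_1_l in Hl.
    rewrite <- qnorm_sqr in Hl |- *; pose proof (qnorm_ge0 (a n)).
    destruct (Rle_lt_dec (qnorm (a n)) 2); nra.
  - intros e I r phi HI Hr.
    set (rho := (1 + Rabs r) / 2); pose proof (Rabs_pos r).
    assert (Hrho : 0 < rho < 1) by (unfold rho; lra).
    assert (Hr' : Rabs r < rho) by (unfold rho; lra).
    pose proof (HS e I rho r phi HI Hrho Hr') as S.
    revert S; apply is_series_ext; intros n.
    rewrite !HA by trivial; rewrite (qdot_imag_skew I e _ HI).
    f_equal; generalize (a n) (cos (INR n * phi)) (sin (INR n * phi)) e I; clear; quat_ring.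
Qed.

(** * Contractivity of multiplication by a bounded slice regular function *)

(* Elements [s + it] of the complexification of the quaternions are pairs [(s, t)],
   [i] commuting with the quaternions. *)
Definition cquat : Type := (quat * quat)%type.

Definition cdot (Y Z : cquat) : R := qdot (fst Y) (fst Z) + qdot (snd Y) (snd Z).

Definition cmul (A P : cquat) : cquat :=
  ((fst A * fst P - snd A * snd P)%quat, (snd A * fst P + fst A * snd P)%quat).

Definition cexp (t : R) (q : quat) : cquat := ((cos t * q)%quat, (sin t * q)%quat).

(** [qdot al (I * be)] is the real part of [I be conj(al)], that is, minus the scalar product of [I]
    with the imaginary part [(w1, w2, w3)] of [be conj(al)]. The maximizing [I] points opposite to
    that vector; if the vector is zero, any unit serves. *)
Lemma qdot_imag_max (al be : quat) : exists I g, imag_unit I /\ 0 <= g /\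
  qdot al (I * be)%quat = g /\
  (let '(_, w1, w2, w3) := (be * qconj al)%quat in g ^ 2 = w1 ^ 2 + w2 ^ 2 + w3 ^ 2).
Proof.
  destruct (be * qconj al)%quat as [[[w0 w1] w2] w3] eqn:E.
  assert (HI : forall i1 i2 i3, qdot al ((0, i1, i2, i3) * be)%quat
    = - (i1 * w1 + i2 * w2 + i3 * w3)).
  { intros i1 i2 i3.
    transitivity (let '(_, v1, v2, v3) := (be * qconj al)%quat in
      - (i1 * v1 + i2 * v2 + i3 * v3)); [clear; quat_ring|now rewrite E]. }
  set (g := sqrt (w1 ^ 2 + w2 ^ 2 + w3 ^ 2)).
  assert (Hw : 0 <= w1 ^ 2 + w2 ^ 2 + w3 ^ 2).
  { pose proof (pow2_ge_0 w1); pose proof (pow2_ge_0 w2); pose proof (pow2_ge_0 w3); lra. }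
  assert (Hg2 : g ^ 2 = w1 ^ 2 + w2 ^ 2 + w3 ^ 2) by now apply pow2_sqrt.
  assert (Hg : 0 <= g) by apply sqrt_pos.
  destruct (Req_dec g 0) as [Hg0|Hg0].
  - assert (Hz : w1 = 0).
    { rewrite Hg0 in Hg2; pose proof (pow2_ge_0 w1); pose proof (pow2_ge_0 w2);
        pose proof (pow2_ge_0 w3); nra. }
    exists (0, 1, 0, 0), g; split; [apply imag_unit_intro; ring|].
    split; [exact Hg|split; [rewrite HI; lra|exact Hg2]].
  - exists (0, - w1 / g, - w2 / g, - w3 / g), g.
    split; [apply imag_unit_intro|split; [exact Hg|split; [rewrite HI|exact Hg2]]].
    + transitivity ((w1 ^ 2 + w2 ^ 2 + w3 ^ 2) / g ^ 2); [field; exact Hg0|].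
      rewrite <- Hg2; field; exact Hg0.
    + transitivity ((w1 ^ 2 + w2 ^ 2 + w3 ^ 2) / g); [field; exact Hg0|].
      rewrite <- Hg2; field; exact Hg0.
Qed.

(* The norm of left multiplication by [al + i be] on the complexification is the
   maximum of [|al + I be|] over the imaginary units [I]. *)
Lemma cmul_norm (A P : cquat) (M : R) :
  (forall I, imag_unit I -> qnorm (fst A + I * snd A)%quat <= M) ->
  cdot (cmul A P) (cmul A P) <= M ^ 2 * cdot P P.
Proof.
  destruct A as [al be], P as [s t]; unfold cdot, cmul; simpl fst; simpl snd; intros HM.
  destruct (qdot_imag_max al be) as (I & g & HI & Hg & EI & Eg).
  (* The left side is [|al + I be|^2] for the maximizing [I]. *)
  assert (H1 : qdot al al + qdot be be + 2 * g <= M ^ 2).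
  { apply Rle_trans with (qnorm (al + I * be)%quat ^ 2).
    - rewrite qnorm_sqr, <- EI; right.
      transitivity (qdot al al + qdot (I * be)%quat (I * be)%quat
        + 2 * qdot al (I * be)%quat).
      + rewrite qdot_mul, <- (qnorm_sqr I), qnorm_imag_unit by exact HI; ring.
      + generalize (I * be)%quat; clear; quat_ring.
    - apply pow_incr; split; [apply qnorm_ge0|now apply HM]. }
  (* Twice the imaginary part of [conj(be) al]; the cross terms of the squared norm of the product
     add up to [2 qdot s (v * t)]. Its norm is [2 g] because [conj(be) al] and [be conj(al)] have
     equal norms and equal real parts. *)
  set (v := (qconj be * al - qconj al * be)%quat).
  assert (Hv : qdot v v = (2 * g) ^ 2).
  { transitivity (4 * g ^ 2); [|ring].
    transitivity (let '(_, w1, w2, w3) := (be * qconj al)%quat in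
      4 * (w1 ^ 2 + w2 ^ 2 + w3 ^ 2)); [unfold v; clear; quat_ring|].
    destruct (be * qconj al)%quat as [[[w0 w1] w2] w3]; now rewrite Eg. }
  assert (H2 : qdot s (v * t)%quat <= g * (qdot s s + qdot t t)).
  { apply Rle_trans with (1 := Rle_abs _), Rle_trans with (1 := Rabs_qdot_le _ _).
    assert (Ev : qnorm v = 2 * g).
    { apply Rsqr_inj; [apply qnorm_ge0|lra|].
      now rewrite !Rsqr_pow2, qnorm_sqr. }
    rewrite qnorm_mul, Ev, <- !qnorm_sqr.
    pose proof (pow2_ge_0 (qnorm s - qnorm t)); nra. }
  replace (_ + _) with ((qdot al al + qdot be be) * (qdot s s + qdot t t)
    + 2 * qdot s (v * t)%quat) by (unfold v; clear; quat_ring).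
  assert (H3 : (qdot al al + qdot be be + 2 * g) * (qdot s s + qdot t t)
    <= M ^ 2 * (qdot s s + qdot t t)).
  { apply Rmult_le_compat_r; [|exact H1].
    pose proof (qdot_sqr_ge0 s); pose proof (qdot_sqr_ge0 t); lra. }
  lra.
Qed.

(** Expand [|M Y - A P|^2 >= 0] and use [cmul_norm]. A sum of squares, unlike a product of norms,
    can be integrated term by term over the circle. *)
Lemma cmul_form_le (Y A P : cquat) (M : R) : 0 < M ->
  (forall I, imag_unit I -> qnorm (fst A + I * snd A)%quat <= M) ->
  cdot Y (cmul A P) <= M / 2 * (cdot Y Y + cdot P P).
Proof.
  intros HM HA; pose proof (cmul_norm A P M HA) as H; revert H.
  generalize (cmul A P); intros X H.
  assert (HX : 0 <= M ^ 2 * cdot Y Y - 2 * M * cdot Y X + cdot X X).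
  { replace (_ + _) with
      (qdot (M * fst Y - fst X)%quat (M * fst Y - fst X)%quat
       + qdot (M * snd Y - snd X)%quat (M * snd Y - snd X)%quat).
    - apply Rplus_le_le_0_compat; apply qdot_sqr_ge0.
    - destruct X as [X1 X2], Y as [Y1 Y2]; unfold cdot; simpl; clear; quat_ring. }
  apply (Rmult_le_reg_l (2 * M)); [lra|]; nra.
Qed.

Lemma is_RInt_sum_n (F : nat -> R -> R) (l : nat -> R) (a b : R) (N : nat) :
  (forall n, is_RInt (F n) a b (l n)) ->
  is_RInt (fun t => sum_n (fun n => F n t) N) a b (sum_n l N).
Proof.
  intros H; induction N as [|N IH].
  - rewrite sum_O; apply (is_RInt_ext (F 0%nat)); [|apply H].
    intros t _; now rewrite sum_O.
  - rewrite sum_Sn; apply (is_RInt_ext (fun t => plus (sum_n (fun n => F n t) N) (F (S N) t))).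
    + intros t _; now rewrite sum_Sn.
    + apply (is_RInt_plus (V := R_NormedModule)); trivial.
Qed.

Definition cadd (Y Z : cquat) : cquat := ((fst Y + fst Z)%quat, (snd Y + snd Z)%quat).

Fixpoint csum (u : nat -> cquat) (N : nat) : cquat :=
  match N with O => u O | S N => cadd (csum u N) (u (S N)) end.

Lemma csum_additive (L : cquat -> R) (u : nat -> cquat) (N : nat) :
  (forall Y Z, L (cadd Y Z) = L Y + L Z) -> L (csum u N) = sum_n (fun n => L (u n)) N.
Proof.
  intros HL; induction N as [|N IH]; [now rewrite sum_O|].
  rewrite sum_Sn; simpl csum; now rewrite HL, IH.
Qed.

Ltac cquat_ring :=
  intros; repeat match goal with Y : cquat |- _ => destruct Y as [? ?] end;
  unfold cadd, cdot, cmul, cexp; simpl fst; simpl snd; quat_ring.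

Lemma cdot_csum (u v : nat -> cquat) (N N' : nat) :
  cdot (csum u N) (csum v N') = sum_n (fun m => sum_n (fun k => cdot (u m) (v k)) N') N.
Proof.
  rewrite (csum_additive (fun Y => cdot Y (csum v N')))
    by (generalize (csum v N'); clear; cquat_ring).
  apply sum_n_ext; intros m; apply (csum_additive (cdot (u m))).
  generalize (u m); clear; cquat_ring.
Qed.

Lemma cdot_cmul_csum (u w v : nat -> cquat) (N D N' : nat) :
  cdot (csum u N) (cmul (csum w D) (csum v N')) =
  sum_n (fun m => sum_n (fun k => sum_n (fun n =>
    cdot (u m) (cmul (w n) (v k))) D) N') N.
Proof.
  rewrite (csum_additive (fun Y => cdot Y (cmul (csum w D) (csum v N'))))
    by (generalize (cmul (csum w D) (csum v N')); clear; cquat_ring).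
  apply sum_n_ext; intros m.
  rewrite (csum_additive (fun P => cdot (u m) (cmul (csum w D) P)))
    by (generalize (u m) (csum w D); clear; cquat_ring).
  apply sum_n_ext; intros k.
  apply (csum_additive (fun A => cdot (u m) (cmul A (v k)))).
  generalize (u m) (v k); clear; cquat_ring.
Qed.

Lemma cdot_cexp (s t : R) (p q : quat) :
  cdot (cexp s p) (cexp t q) = qdot p q * cos (s - t).
Proof. unfold cexp; rewrite cos_minus; generalize (cos s) (sin s) (cos t) (sin t); cquat_ring. Qed.

Lemma cmul_cexp (s t : R) (p q : quat) :
  cmul (cexp s p) (cexp t q) = cexp (s + t) (p * q)%quat.
Proof.
  unfold cexp; rewrite cos_plus, sin_plus.
  generalize (cos s) (sin s) (cos t) (sin t); intros.
  unfold cmul; simpl fst; simpl snd; f_equal; quat_ring.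
Qed.

Lemma is_RInt_cos_diff (c : R) (m n : nat) :
  is_RInt (fun t => c * cos (INR m * t - INR n * t)) 0 (2 * PI)
    (if (m =? n)%nat then 2 * PI * c else 0).
Proof.
  assert (E : RInt (fun t => cos (INR m * t - INR n * t)) 0 (2 * PI)
    = if (m =? n)%nat then 2 * PI else 0).
  { destruct (Nat.eqb_spec m n) as [->|Hmn].
    - rewrite (RInt_ext _ (fun _ => 1)).
      + rewrite RInt_const; unfold scal; simpl; unfold mult; simpl; ring.
      + intros t _; now rewrite Rminus_diag, cos_0.
    - destruct (Nat.lt_ge_cases m n) as [Hlt|Hge].
      + rewrite (RInt_ext _ (fun t => cos (INR (n - m) * (0 - t)))).
        * apply (RInt_cos_lin _ _ (n - m)); [lia|reflexivity].
        * intros t _; f_equal; rewrite minus_INR by lia; real_ring.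
      + rewrite (RInt_ext _ (fun t => cos (INR (m - n) * (0 - t)))).
        * apply (RInt_cos_lin _ _ (m - n)); [lia|reflexivity].
        * intros t _; rewrite <- (cos_neg (INR (m - n) * (0 - t))).
          f_equal; rewrite minus_INR by lia; real_ring. }
  assert (Hc : forall t, continuous (fun t => cos (INR m * t - INR n * t)) t).
  { intros t; apply (ex_derive_continuous (V := R_NormedModule)); auto_derive; trivial. }
  assert (H : is_RInt (fun t => c * cos (INR m * t - INR n * t)) 0 (2 * PI)
    (c * RInt (fun t => cos (INR m * t - INR n * t)) 0 (2 * PI))).
  { apply (is_RInt_scal (V := R_NormedModule)
      (fun t => cos (INR m * t - INR n * t)) 0 (2 * PI) c).
    apply (RInt_correct (V := R_CompleteNormedModule)), ex_RInt_cont, Hc. }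
  rewrite E in H; destruct (m =? n)%nat.
  - now replace (2 * PI * c) with (c * (2 * PI)) by ring.
  - now rewrite Rmult_0_r in H.
Qed.

Lemma sum_n_delta (F : nat -> R) (N j : nat) :
  sum_n (fun n => if (j =? n)%nat then F n else 0) N = if (j <=? N)%nat then F j else 0.
Proof.
  induction N as [|N IH].
  - rewrite sum_O; destruct j; reflexivity.
  - rewrite sum_Sn, IH; unfold plus; simpl.
    destruct (Nat.leb_spec j N), (Nat.leb_spec j (S N)), (Nat.eqb_spec j (S N));
      subst; try lia; real_ring.
Qed.

(* The lower triangular Toeplitz matrix of multiplication by [sum q^n a_(n+1)],
   whose entries one step above the diagonal are [a_0]. *)
Definition toeplitz (a : nat -> quat) (m k : nat) : quat :=
  if (k <=? S m)%nat then a (S m - k)%nat else 0.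

(** Parseval: [cmul_form_le] is integrated over the circle with [p k] at frequency [k] and [y m] at
    frequency [S m]. The integral of [cdot Y (A P)] keeps the terms with [n + k = S m], which are
    the entries of [toeplitz]; the shift by one encodes the division of [f] by [q]. The largest
    index that occurs is [S N], hence [S N <= D]. *)
Lemma toeplitz_form_le_poly (a y p : nat -> quat) (M : R) (N D : nat) :
  0 < M -> (S N <= D)%nat ->
  (forall t I, imag_unit I -> let A := csum (fun n => cexp (INR n * t) (a n)) D in
    qnorm (fst A + I * snd A)%quat <= M) ->
  sum_n (fun m => sum_n (fun k => qdot (y m) (toeplitz a m k * p k)%quat) N) N <=
  M / 2 * (sum_n (fun m => qdot (y m) (y m)) N + sum_n (fun k => qdot (p k) (p k)) N).
Proof.
  intros HM HD HA.
  set (Y := fun t => csum (fun m => cexp (INR (S m) * t) (y m)) N).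
  set (P := fun t => csum (fun k => cexp (INR k * t) (p k)) N).
  set (A := fun t => csum (fun n => cexp (INR n * t) (a n)) D).
  assert (Hle : forall t, cdot (Y t) (cmul (A t) (P t))
    <= M / 2 * (cdot (Y t) (Y t) + cdot (P t) (P t))).
  { intros t; apply cmul_form_le; [exact HM|intros I HI; now apply HA]. }
  (* The injective frequency assignment [j] covers both [S] for [y] and the identity for [p]. *)
  assert (HS : forall (j : nat -> nat) (v : nat -> quat), (forall m n, j m = j n -> m = n) ->
    is_RInt (fun t => cdot (csum (fun m => cexp (INR (j m) * t) (v m)) N)
      (csum (fun m => cexp (INR (j m) * t) (v m)) N)) 0 (2 * PI)
      (2 * PI * sum_n (fun m => qdot (v m) (v m)) N)).
  { intros j v Hj.
    replace (2 * PI * sum_n (fun m => qdot (v m) (v m)) N) with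
      (sum_n (fun m => sum_n (fun k =>
        if (j m =? j k)%nat then 2 * PI * qdot (v m) (v k) else 0) N) N).
    - apply (is_RInt_ext (fun t => sum_n (fun m => sum_n (fun k =>
        qdot (v m) (v k) * cos (INR (j m) * t - INR (j k) * t)) N) N)).
      + intros t _; rewrite cdot_csum; apply sum_n_ext; intros m.
        apply sum_n_ext; intros k; now rewrite cdot_cexp.
      + apply is_RInt_sum_n; intros m.
        apply (is_RInt_sum_n (fun k t => qdot (v m) (v k)
          * cos (INR (j m) * t - INR (j k) * t))).
        intros k; apply is_RInt_cos_diff.
    - transitivity (sum_n (fun m => 2 * PI * qdot (v m) (v m)) N).
      + apply sum_n_ext_loc; intros m Hm.
        rewrite (sum_n_ext _ (fun k => if (m =? k)%nat then 2 * PI * qdot (v m) (v k) else 0)).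
        * rewrite sum_n_delta; destruct (Nat.leb_spec m N); [reflexivity|lia].
        * intros k; destruct (Nat.eqb_spec (j m) (j k)); destruct (Nat.eqb_spec m k);
            try reflexivity; subst; exfalso; auto.
      + apply (sum_n_mult_l (K := R_Ring)). }
  assert (HYY := HS S y (fun m n => eq_add_S m n)).
  assert (HPP := HS (fun k => k) p (fun m n E => E)).
  assert (HYAP : is_RInt (fun t => cdot (Y t) (cmul (A t) (P t))) 0 (2 * PI)
    (2 * PI * sum_n (fun m => sum_n (fun k => qdot (y m) (toeplitz a m k * p k)%quat) N) N)).
  { replace (2 * PI * _) with (sum_n (fun m => sum_n (fun k => sum_n (fun n =>
      if (S m =? n + k)%nat then 2 * PI * qdot (y m) (a n * p k)%quat else 0) D) N) N).
    - apply (is_RInt_ext (fun t => sum_n (fun m => sum_n (fun k => sum_n (fun n =>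
        qdot (y m) (a n * p k)%quat * cos (INR (S m) * t - INR (n + k) * t)) D) N) N)).
      + intros t _; unfold Y, A, P; rewrite cdot_cmul_csum.
        apply sum_n_ext; intros m; apply sum_n_ext; intros k; apply sum_n_ext; intros n.
        rewrite cmul_cexp, cdot_cexp, plus_INR; do 2 f_equal; real_ring.
      + apply is_RInt_sum_n; intros m.
        apply (is_RInt_sum_n (fun k t => sum_n (fun n => qdot (y m) (a n * p k)%quat
          * cos (INR (S m) * t - INR (n + k) * t)) D)); intros k.
        apply (is_RInt_sum_n (fun n t => qdot (y m) (a n * p k)%quat
          * cos (INR (S m) * t - INR (n + k) * t))); intros n.
        apply is_RInt_cos_diff.
    - transitivity (sum_n (fun m => 2 * PI *
        sum_n (fun k => qdot (y m) (toeplitz a m k * p k)%quat) N) N);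
        [|apply (sum_n_mult_l (K := R_Ring))].
      apply sum_n_ext_loc; intros m Hm.
      transitivity (sum_n (fun k => 2 * PI * qdot (y m) (toeplitz a m k * p k)%quat) N);
        [|apply (sum_n_mult_l (K := R_Ring))].
      apply sum_n_ext_loc; intros k Hk; unfold toeplitz.
      destruct (Nat.leb_spec k (S m)) as [Hkm|Hkm].
      + rewrite (sum_n_ext _ (fun n => if (S m - k =? n)%nat
          then 2 * PI * qdot (y m) (a n * p k)%quat else 0)).
        * rewrite sum_n_delta; destruct (Nat.leb_spec (S m - k) D); [reflexivity|lia].
        * intros n; destruct (Nat.eqb_spec (S m) (n + k));
            destruct (Nat.eqb_spec (S m - k) n); trivial; lia.
      + rewrite (sum_n_ext _ (fun n => 0)).
        * transitivity 0; [|generalize (y m) (p k); clear; quat_ring].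
          rewrite sum_n_const; real_ring.
        * intros n; destruct (Nat.eqb_spec (S m) (n + k)); trivial; lia. }
  pose proof PI_RGT_0 as Hpi.
  apply (Rmult_le_reg_l (2 * PI)); [lra|].
  set (SY := sum_n (fun m => qdot (y m) (y m)) N) in *.
  set (SP := sum_n (fun k => qdot (p k) (p k)) N) in *.
  apply Rle_trans with (M / 2 * (2 * PI * SY + 2 * PI * SP)); [|right; real_ring].
  assert (H2pi : 0 <= 2 * PI) by lra.
  apply (is_RInt_le _ _ 0 (2 * PI) _ _ H2pi HYAP
    (is_RInt_scal (V := R_NormedModule) _ _ _ (M / 2) _
      (is_RInt_plus (V := R_NormedModule) _ _ _ _ _ _ HYY HPP))).
  intros t _; apply Hle.
Qed.

Lemma series_tail_le (u : nat -> R) (l C r : R) (D : nat) :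
  0 <= r < 1 -> (forall n, Rabs (u n) <= C * r ^ n) -> is_series u l ->
  Rabs (l - sum_n u D) <= C * r ^ S D / (1 - r).
Proof.
  intros Hr Hu Hl.
  assert (Hw : is_series (fun k => C * r ^ S D * r ^ k) (C * r ^ S D * / (1 - r))).
  { assert (Hr' : Rabs r < 1) by (rewrite Rabs_pos_eq; lra).
    exact (is_series_scal_l (C * r ^ S D) _ _ (is_series_geom r Hr')). }
  assert (Hk : forall k, 0 <= Rabs (u (S D + k)%nat) <= C * r ^ S D * r ^ k).
  { intros k; split; [apply Rabs_pos|].
    rewrite Rmult_assoc, <- pow_add; apply Hu. }
  assert (Hex : ex_series (fun k => Rabs (u (S D + k)%nat))).
  { apply (ex_series_le (V := R_CompleteNormedModule) _ (fun k => C * r ^ S D * r ^ k)).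
    - intros k; change (Rabs (Rabs (u (S D + k)%nat)) <= C * r ^ S D * r ^ k).
      rewrite Rabs_Rabsolu; apply Hk.
    - eexists; exact Hw. }
  assert (Htail : Series (fun k => u (S D + k)%nat) = l - sum_n u D).
  { apply is_series_unique.
    apply (is_series_incr_n u (S D)); [lia|]; simpl Nat.pred.
    match goal with |- is_series _ ?x => replace x with l end; [exact Hl|].
    change (l = l - sum_n u D + sum_n u D); ring. }
  rewrite <- Htail.
  apply Rle_trans with (1 := Series_Rabs _ Hex).
  apply Rle_trans with (Series (fun k => C * r ^ S D * r ^ k)).
  - apply Series_le; [exact Hk|eexists; exact Hw].
  - rewrite (is_series_unique _ _ Hw); right; reflexivity.
Qed.

(* Weak form of [f q = sum q^n a_n]: quaternionic series are paired with an arbitrary [e],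
   so that only real series occur. *)
Definition slice_series (a : nat -> quat) (f : quat -> quat) : Prop :=
  forall e I r phi, imag_unit I -> Rabs r < 1 ->
  is_series (fun n => r ^ n *
      qdot e (slice_point I (cos (INR n * phi)) (sin (INR n * phi)) * a n)%quat)
    (qdot e (f (slice_point I (r * cos phi) (r * sin phi)))).

(** Replacing [i] by [I] in the complexified polynomial gives the partial sum [v] of the series of
    [f] at [r e^{I t}]. Pairing with [v] itself bounds [|v|^2] by [|v|] times [|f| < 1] plus the
    geometric tail, and then [|v|] is cancelled. *)
Lemma slice_partial_sum_le (a : nat -> quat) (f : quat -> quat) (r : R) (D : nat) :
  (forall n, qnorm (a n) <= 2) -> slice_series a f ->
  (forall q, unit_ball q -> unit_ball (f q)) -> 0 <= r < 1 ->
  forall t I, imag_unit I ->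
  let A := csum (fun n => cexp (INR n * t) (r ^ n * a n)%quat) D in
  qnorm (fst A + I * snd A)%quat <= 1 + 2 * r ^ S D / (1 - r).
Proof.
  intros Ha Hf Hball Hr t I HI A.
  set (v := (fst A + I * snd A)%quat).
  set (u := fun n => r ^ n *
    qdot v (slice_point I (cos (INR n * t)) (sin (INR n * t)) * a n)%quat).
  assert (Hr' : Rabs r < 1) by (rewrite Rabs_pos_eq; lra).
  pose proof (Hf v I r t HI Hr') as Hs; fold u in Hs.
  assert (Ev : qdot v v = sum_n u D).
  { transitivity (qdot v (fst A + I * snd A)%quat); [reflexivity|].
    unfold A; rewrite (csum_additive (fun A => qdot v (fst A + I * snd A)%quat))
      by (generalize v I; clear; cquat_ring).
    apply sum_n_ext; intros n; unfold u, cexp; simpl fst; simpl snd.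
    generalize (a n) (cos (INR n * t)) (sin (INR n * t)) (r ^ n) v I; clear; quat_ring. }
  assert (Hu : forall n, Rabs (u n) <= 2 * qnorm v * r ^ n).
  { intros n; unfold u; rewrite Rabs_mult, (Rabs_pos_eq (r ^ n)) by (apply pow_le; lra).
    rewrite Rmult_comm; apply Rmult_le_compat_r; [apply pow_le; lra|].
    apply Rle_trans with (1 := Rabs_qdot_le _ _); rewrite qnorm_mul.
    assert (E1 : qnorm (slice_point I (cos (INR n * t)) (sin (INR n * t))) <= 1).
    { apply qnorm_le; [lra|]; rewrite qdot_slice_point by exact HI.
      pose proof (sin2_cos2 (INR n * t)); unfold Rsqr in *; lra. }
    specialize (Ha n); pose proof (qnorm_ge0 v); pose proof (qnorm_ge0 (a n)).
    rewrite Rmult_comm; apply Rmult_le_compat_r; [assumption|].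
    apply Rle_trans with (1 * qnorm (a n)); [|lra].
    now apply Rmult_le_compat_r. }
  pose proof (series_tail_le u _ _ r D Hr Hu Hs) as Ht.
  assert (Hfv : qdot v (f (slice_point I (r * cos t) (r * sin t))) <= qnorm v).
  { apply Rle_trans with (1 := Rle_abs _), Rle_trans with (1 := Rabs_qdot_le _ _).
    assert (Hb : unit_ball (f (slice_point I (r * cos t) (r * sin t)))).
    { apply Hball, slice_point_unit_ball; trivial; now apply circle_in_disc. }
    unfold unit_ball in Hb; pose proof (qnorm_ge0 v); nra. }
  rewrite <- Ev, <- qnorm_sqr in Ht; apply Rabs_le_between in Ht.
  set (eps := 2 * r ^ S D / (1 - r)).
  assert (Heps : 2 * qnorm v * r ^ S D / (1 - r) = qnorm v * eps) by (unfold eps; field; lra).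
  rewrite Heps in Ht; pose proof (qnorm_ge0 v) as Hv.
  assert (Heps0 : 0 <= eps).
  { unfold eps; apply Rmult_le_pos; [|left; apply Rinv_0_lt_compat; lra].
    apply Rmult_le_pos; [lra|apply pow_le; lra]. }
  destruct (Req_dec (qnorm v) 0); [lra|].
  apply (Rmult_le_reg_l (qnorm v)); lra.
Qed.

Lemma continuous_sum_n (F : nat -> R -> R) (N : nat) (x : R) :
  (forall n, continuous (F n) x) -> continuous (fun t => sum_n (fun n => F n t) N) x.
Proof.
  intros H; induction N as [|N IH].
  - apply (continuous_ext (F 0%nat)); [|apply H]; intros t; now rewrite sum_O.
  - apply (continuous_ext (fun t => sum_n (fun n => F n t) N + F (S N) t)).
    + intros t; now rewrite sum_Sn.
    + now apply continuous_Rplus.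
Qed.

Lemma sum_n_qdot_ge0 (p : nat -> quat) (N : nat) : 0 <= sum_n (fun k => qdot (p k) (p k)) N.
Proof.
  induction N as [|N IH]; [rewrite sum_O; apply qdot_sqr_ge0|].
  rewrite sum_Sn; apply Rplus_le_le_0_compat; [exact IH|apply qdot_sqr_ge0].
Qed.

(** For the coefficients [r^n a_n] with [r < 1], truncation at a large degree [D] raises the bound 1
    only to [1 + eps]. The form has finitely many entries, each continuous in [r], so [r] may then
    tend to 1. *)
Lemma toeplitz_form_le (a y p : nat -> quat) (f : quat -> quat) (N : nat) :
  (forall n, qnorm (a n) <= 2) -> slice_series a f ->
  (forall q, unit_ball q -> unit_ball (f q)) ->
  sum_n (fun m => sum_n (fun k => qdot (y m) (toeplitz a m k * p k)%quat) N) N <=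
  1 / 2 * (sum_n (fun m => qdot (y m) (y m)) N + sum_n (fun k => qdot (p k) (p k)) N).
Proof.
  intros Ha Hf Hball.
  set (B := sum_n (fun m => qdot (y m) (y m)) N + sum_n (fun k => qdot (p k) (p k)) N).
  assert (HB : 0 <= B) by (apply Rplus_le_le_0_compat; apply sum_n_qdot_ge0).
  set (g := fun r => sum_n (fun m => sum_n (fun k =>
    qdot (y m) (toeplitz (fun n => (r ^ n * a n)%quat) m k * p k)%quat) N) N).
  assert (Hg1 : g 1 = sum_n (fun m => sum_n (fun k =>
    qdot (y m) (toeplitz a m k * p k)%quat) N) N).
  { apply sum_n_ext; intros m; apply sum_n_ext; intros k; unfold toeplitz.
    destruct (k <=? S m)%nat; trivial; rewrite pow1.
    generalize (a (S m - k)%nat) (y m) (p k); clear; quat_ring. }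
  rewrite <- Hg1; apply le_left_limit.
  - apply (continuous_sum_n (fun m r => sum_n (fun k =>
      qdot (y m) (toeplitz (fun n => (r ^ n * a n)%quat) m k * p k)%quat) N)); intros m.
    apply (continuous_sum_n (fun k r =>
      qdot (y m) (toeplitz (fun n => (r ^ n * a n)%quat) m k * p k)%quat)); intros k.
    unfold toeplitz; destruct (k <=? S m)%nat; [|apply continuous_const].
    apply (continuous_ext (fun r => r ^ (S m - k) * qdot (y m) (a (S m - k)%nat * p k)%quat)).
    + intros r; generalize (r ^ (S m - k)) (a (S m - k)%nat) (y m) (p k); clear; quat_ring.
    + apply (ex_derive_continuous (V := R_NormedModule)); auto_derive; trivial.
  - intros r Hr; apply le_epsilon; intros eta Heta.
    (* [B] may be zero, hence the denominator [B + 1]. *)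
    set (eps := eta / (B + 1)).
    assert (Heps : 0 < eps) by (apply Rdiv_lt_0_compat; lra).
    assert (Hlim : is_lim_seq (fun n => 2 * r / (1 - r) * r ^ n) 0)
      by (apply is_lim_seq_geom_scal; rewrite Rabs_pos_eq; lra).
    apply is_lim_seq_spec in Hlim; destruct (Hlim (mkposreal eps Heps)) as [D0 HD0].
    simpl pos in HD0.
    set (D := (D0 + S N)%nat).
    assert (HD : forall t I, imag_unit I ->
      let A := csum (fun n => cexp (INR n * t) (r ^ n * a n)%quat) D in
      qnorm (fst A + I * snd A)%quat <= 1 + eps).
    { intros t I HI A.
      assert (Hr0 : 0 <= r < 1) by lra.
      apply Rle_trans with (1 := slice_partial_sum_le a f r D Ha Hf Hball Hr0 t I HI).
      assert (HDD : (D0 <= D)%nat) by (unfold D; lia).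
      specialize (HD0 D HDD); rewrite Rminus_0_r in HD0.
      apply Rabs_def2 in HD0.
      replace (2 * r ^ S D / (1 - r)) with (2 * r / (1 - r) * r ^ D)
        by (simpl; field; lra).
      lra. }
    assert (H1eps : 0 < 1 + eps) by lra.
    assert (HND : (S N <= D)%nat) by (unfold D; lia).
    apply Rle_trans with (1 := toeplitz_form_le_poly _ y p (1 + eps) N D H1eps HND HD).
    fold B.
    assert (Hfin : eps * B <= eta).
    { apply Rle_trans with (eps * (B + 1)); [nra|].
      right; unfold eps; field; lra. }
    nra.
Qed.

(** * The Pick inequality *)

(** Each term is paired with itself so that [csum_additive] applies to quaternionic sums. *)
Definition qsum (u : nat -> quat) (N : nat) : quat := fst (csum (fun n => (u n, u n)) N).

Lemma qdot_qsum (x : quat) (u : nat -> quat) (N : nat) :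
  qdot x (qsum u N) = sum_n (fun n => qdot x (u n)) N.
Proof.
  unfold qsum; rewrite (csum_additive (fun Y => qdot x (fst Y)))
    by (generalize x; clear; cquat_ring).
  reflexivity.
Qed.

Lemma qdot_adjoint (y c x : quat) : qdot y (c * x)%quat = qdot x (qconj c * y)%quat.
Proof. revert y c x; quat_ring. Qed.

(** The form is tested on [y] and on [p], the image of [y] under the adjoint. Its value is then the
    squared norm of [p], half of which is absorbed from the right-hand side. *)
Lemma toeplitz_adjoint_contraction (a y : nat -> quat) (f : quat -> quat) (N : nat) :
  (forall n, qnorm (a n) <= 2) -> slice_series a f ->
  (forall q, unit_ball q -> unit_ball (f q)) ->
  let p k := qsum (fun m => (qconj (toeplitz a m k) * y m)%quat) N in
  sum_n (fun k => qdot (p k) (p k)) N <= sum_n (fun m => qdot (y m) (y m)) N.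
Proof.
  intros Ha Hf Hball p.
  pose proof (toeplitz_form_le a y p f N Ha Hf Hball) as H.
  rewrite sum_n_switch in H.
  rewrite (sum_n_ext _ (fun k => qdot (p k) (p k))) in H.
  - set (SP := sum_n (fun k => qdot (p k) (p k)) N) in *.
    set (SY := sum_n (fun m => qdot (y m) (y m)) N) in *; lra.
  - intros k; unfold p at 3; rewrite qdot_qsum; apply sum_n_ext; intros m.
    apply qdot_adjoint.
Qed.

Lemma is_lim_seq_sum_n (F : nat -> nat -> R) (l : nat -> R) (K : nat) :
  (forall k, is_lim_seq (F k) (l k)) ->
  is_lim_seq (fun N => sum_n (fun k => F k N) K) (sum_n l K).
Proof.
  intros H; induction K as [|K IH].
  - apply (is_lim_seq_ext (F 0%nat)); [intros N; now rewrite sum_O|].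
    rewrite sum_O; apply H.
  - apply (is_lim_seq_ext (fun N => sum_n (fun k => F k N) K + F (S K) N)).
    + intros N; now rewrite sum_Sn.
    + rewrite sum_Sn; now apply is_lim_seq_plus'.
Qed.

Lemma sum_n_ge0_mono (u : nat -> R) (K N : nat) :
  (forall n, 0 <= u n) -> (K <= N)%nat -> sum_n u K <= sum_n u N.
Proof.
  intros Hu; induction 1 as [|N HKN IH]; [lra|].
  rewrite sum_Sn; specialize (Hu (S N)); unfold plus; simpl; lra.
Qed.

(* Weak lower semicontinuity of the norm: [2 <l, v> - |l|^2 <= |v|^2]. *)
Lemma sum_sqr_weak_limit_le (v : nat -> nat -> quat) (l : nat -> quat) (B : R) (K : nat) :
  (forall k x, is_lim_seq (fun N => qdot x (v N k)) (qdot x (l k))) ->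
  (forall N, (K <= N)%nat -> sum_n (fun k => qdot (v N k) (v N k)) K <= B) ->
  sum_n (fun k => qdot (l k) (l k)) K <= B.
Proof.
  intros Hl HB.
  assert (Hlim : is_lim_seq (fun N => sum_n (fun k =>
      2 * qdot (l k) (v N k) - qdot (l k) (l k)) K)
    (sum_n (fun k => 2 * qdot (l k) (l k) - qdot (l k) (l k)) K)).
  { apply (is_lim_seq_sum_n (fun k N => 2 * qdot (l k) (v N k) - qdot (l k) (l k))).
    intros k; apply is_lim_seq_minus'; [|apply is_lim_seq_const].
    apply (is_lim_seq_scal_l _ 2 (Finite (qdot (l k) (l k)))); apply Hl. }
  rewrite (sum_n_ext _ (fun k => 2 * qdot (l k) (l k) - qdot (l k) (l k)))
    by (intros; real_ring).
  refine (is_lim_seq_le_loc _ (fun _ => B) _ B _ Hlim (is_lim_seq_const B)).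
  exists K; intros N HN; apply Rle_trans with (2 := HB N HN).
  clear; induction K as [|K IH].
  - rewrite !sum_O; pose proof (qdot_sqr_ge0 (l 0%nat - v N 0%nat)%quat) as H.
    replace (qdot _ _) with (qdot (l 0%nat) (l 0%nat) - 2 * qdot (l 0%nat) (v N 0%nat)
      + qdot (v N 0%nat) (v N 0%nat)) in H; [lra|].
    generalize (l 0%nat) (v N 0%nat); clear; quat_ring.
  - rewrite !sum_Sn; apply Rplus_le_compat; [exact IH|].
    pose proof (qdot_sqr_ge0 (l (S K) - v N (S K))%quat) as H.
    replace (qdot _ _) with (qdot (l (S K)) (l (S K)) - 2 * qdot (l (S K)) (v N (S K))
      + qdot (v N (S K)) (v N (S K))) in H; [lra|].
    generalize (l (S K)) (v N (S K)); clear; quat_ring.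
Qed.

(** * Powers and polar form of a quaternion *)

Fixpoint qpow (q : quat) (n : nat) : quat :=
  match n with O => 1 | S n => (q * qpow q n)%quat end.

Lemma qdot_qpow (q : quat) (n : nat) : qdot (qpow q n) (qpow q n) = qdot q q ^ n.
Proof.
  induction n as [|n IH]; simpl; [unfold qdot, quat_of_R; ring|].
  now rewrite qdot_mul, IH.
Qed.

Lemma qpow_add (q : quat) (m n : nat) : qpow q (m + n) = (qpow q m * qpow q n)%quat.
Proof.
  induction m as [|m IH]; simpl; [generalize (qpow q n); clear; quat_ring|].
  now rewrite IH, qmul_assoc.
Qed.

Lemma qpow_slice_point (I : quat) (r phi : R) (n : nat) : imag_unit I ->
  qpow (slice_point I (r * cos phi) (r * sin phi)) n =
  (r ^ n * slice_point I (cos (INR n * phi)) (sin (INR n * phi)))%quat.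
Proof.
  intros HI; induction n as [|n IH].
  - simpl; rewrite Rmult_0_l, cos_0, sin_0; clear; quat_ring.
  - simpl qpow; rewrite IH, S_INR, Rmult_plus_distr_r, Rmult_1_l, cos_plus, sin_plus.
    simpl pow; generalize (cos phi) (sin phi) (cos (INR n * phi)) (sin (INR n * phi)) (r ^ n).
    intros c d c' d' s.
    transitivity ((r * s)%R * ((c' * c)%R + (c' * d + d' * c)%R * I
      + (d' * d)%R * (I * I)))%quat.
    + clear; quat_ring.
    + rewrite HI; clear; quat_ring.
Qed.

Lemma polar_unit (x y : R) : x ^ 2 + y ^ 2 = 1 -> exists t, cos t = x /\ sin t = y.
Proof.
  intros H; assert (Hx : -1 <= x <= 1) by nra.
  assert (Hs : sin (acos x) = sqrt (y ^ 2)).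
  { rewrite sin_acos by exact Hx; f_equal; unfold Rsqr; lra. }
  destruct (Rle_lt_dec 0 y) as [Hy|Hy].
  - exists (acos x); split; [now apply cos_acos|].
    rewrite Hs; now apply sqrt_pow2.
  - exists (- acos x); rewrite cos_neg, sin_neg, Hs; split; [now apply cos_acos|].
    replace (y ^ 2) with ((- y) ^ 2) by ring.
    rewrite sqrt_pow2 by lra; ring.
Qed.

Lemma quat_polar (q : quat) : exists I r phi, imag_unit I /\ 0 <= r /\
  q = slice_point I (r * cos phi) (r * sin phi).
Proof.
  destruct q as [[[x b] c] d].
  set (y := sqrt (b ^ 2 + c ^ 2 + d ^ 2)).
  assert (Hp : 0 <= b ^ 2 + c ^ 2 + d ^ 2) by nra.
  assert (Hy : y ^ 2 = b ^ 2 + c ^ 2 + d ^ 2) by now apply pow2_sqrt.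
  assert (HI : exists I, imag_unit I /\ ((x, b, c, d) : quat) = slice_point I x y).
  { destruct (Req_dec y 0) as [Hy0|Hy0].
    - exists (0, 1, 0, 0); split; [apply imag_unit_intro; ring|].
      rewrite Hy0 in Hy |- *.
      assert (b = 0) by nra; assert (c = 0) by nra; assert (d = 0) by nra; subst.
      clear; quat_ring.
    - exists (0, b / y, c / y, d / y); split.
      + apply imag_unit_intro; transitivity ((b ^ 2 + c ^ 2 + d ^ 2) / y ^ 2);
          [field; exact Hy0|rewrite <- Hy; field; exact Hy0].
      + unfold slice_point, qadd, qmul, quat_of_R; repeat f_equal; field; exact Hy0. }
  destruct HI as (I & HI & ->).
  set (r := sqrt (x ^ 2 + y ^ 2)).
  assert (Hr : r ^ 2 = x ^ 2 + y ^ 2) by (apply pow2_sqrt; nra).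
  assert (Hr0 : 0 <= r) by apply sqrt_pos.
  destruct (Req_dec r 0) as [Hz|Hz].
  - exists I, 0, 0; split; [exact HI|split; [lra|]].
    rewrite Hz in Hr; assert (x = 0) by nra; assert (Hyz : y = 0) by nra.
    rewrite Hyz; subst x; now rewrite !Rmult_0_l.
  - destruct (polar_unit (x / r) (y / r)) as [t [Ec Es]].
    { transitivity ((x ^ 2 + y ^ 2) / r ^ 2); [field; exact Hz|rewrite <- Hr; field; exact Hz]. }
    exists I, r, t; split; [exact HI|split; [exact Hr0|]].
    rewrite Ec, Es; f_equal; field; exact Hz.
Qed.

Lemma slice_series_qpow (a : nat -> quat) (f : quat -> quat) (q e : quat) :
  slice_series a f -> unit_ball q ->
  is_series (fun n => qdot e (qpow q n * a n)%quat) (qdot e (f q)).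
Proof.
  intros Hf Hq; destruct (quat_polar q) as (I & r & phi & HI & Hr & ->).
  assert (Hr1 : Rabs r < 1).
  { rewrite unit_ball_dot, qdot_slice_point in Hq by exact HI.
    rewrite Rabs_pos_eq by exact Hr.
    pose proof (sin2_cos2 phi) as E; unfold Rsqr in E; nra. }
  apply (is_series_ext (fun n => r ^ n * qdot e
    (slice_point I (cos (INR n * phi)) (sin (INR n * phi)) * a n)%quat));
    [|now apply Hf].
  intros n; rewrite qpow_slice_point by exact HI.
  generalize (slice_point I (cos (INR n * phi)) (sin (INR n * phi))) (a n) (r ^ n) e.
  clear; quat_ring.
Qed.

Lemma is_series_zero_prefix (u : nat -> R) (l : R) (k : nat) :
  (forall n, (n < k)%nat -> u n = 0) -> is_series (fun n => u (k + n)%nat) l ->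
  is_series u l.
Proof.
  destruct k as [|k]; [trivial|]; intros Hz H.
  apply (is_series_decr_n u (S k)); [lia|]; simpl Nat.pred.
  assert (E : sum_n u k = 0).
  { rewrite (sum_n_ext_loc _ (fun _ => 0)) by (intros n Hn; apply Hz; lia).
    rewrite sum_n_const; real_ring. }
  match goal with |- is_series _ ?x => replace x with l end; [exact H|].
  change (l = l + - sum_n u k); rewrite E; ring.
Qed.

Lemma is_series_at_0 (c : R) : is_series (fun n => if (n =? 0)%nat then c else 0) c.
Proof.
  change (is_lim_seq (sum_n (fun n => if (n =? 0)%nat then c else 0)) c).
  apply (is_lim_seq_ext (fun _ => c)); [|apply is_lim_seq_const].
  intros N; induction N as [|N IH]; [now rewrite sum_O|].
  rewrite sum_Sn, <- IH; simpl; unfold plus; simpl; real_ring.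
Qed.

(* The two-point Pick inequality at [0] and [q] for [g = sum q^n a_(n+1)], tested on
   the vector [(u, 1)]. *)
Lemma pick_form (a : nat -> quat) (f : quat -> quat) (q w u : quat) :
  (forall n, qnorm (a n) <= 2) -> slice_series a f ->
  (forall q, unit_ball q -> unit_ball (f q)) -> a 0%nat = 0 ->
  unit_ball q -> f q = (q * w)%quat -> 0 < qdot q q ->
  let Q := qdot q q in
  qdot (qconj (a 1%nat) * u + qconj w)%quat (qconj (a 1%nat) * u + qconj w)%quat
    + Q / (1 - Q) * qdot w w <= qdot (u + 1)%quat (u + 1)%quat + Q / (1 - Q).
Proof.
  intros Ha Hf Hball Ha0 Hq Efq HQ Q.
  assert (HQ1 : Q < 1) by now apply unit_ball_dot.
  (* [y] is the kernel at 0 times [u] plus the kernel at [q]; [l] is its image under the adjoint of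
     the full infinite matrix. *)
  set (y := fun m => ((if (m =? 0)%nat then u else 0) + qconj (qpow q m))%quat).
  set (l := fun k => (qconj (toeplitz a 0 k) * u + qconj (qpow q k * w))%quat).
  (* Division by [q]: pairing the series of [f q = q w] with [q * e] brings out a factor [|q|^2],
     and the term [n = 0] vanishes with [a 0]. *)
  assert (Hg : forall e, is_series (fun n => qdot e (qpow q n * a (S n))%quat) (qdot e w)).
  { intros e; pose proof (slice_series_qpow a f q (q * e)%quat Hf Hq) as H.
    rewrite Efq in H; apply (is_series_scal_l (/ Q)) in H.
    assert (El : / Q * qdot (q * e)%quat (q * w)%quat = qdot e w).
    { transitivity (/ Q * (Q * qdot e w)); [|field; unfold Q; lra].
      unfold Q; f_equal; generalize q e w; clear; quat_ring. }
    assert (H' : is_series (fun n => / Q * qdot (q * e)%quat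
      (qpow q (S n) * a (S n))%quat) (/ Q * qdot (q * e)%quat (q * w)%quat)).
    { apply (is_series_incr_1 (fun n => / Q * qdot (q * e)%quat (qpow q n * a n)%quat)).
      match goal with |- is_series _ ?x =>
        replace x with (scal (/ Q) (qdot (q * e)%quat (q * w)%quat)); [exact H|] end.
      rewrite Ha0; unfold plus, scal, mult; simpl; unfold mult; simpl.
      generalize q e w (/ Q); clear; quat_ring. }
    rewrite El in H'.
    revert H'; apply is_series_ext; intros n; simpl qpow; real_eq.
    transitivity (/ Q * (Q * qdot e (qpow q n * a (S n))%quat)); [|field; unfold Q; lra].
    unfold Q; f_equal; generalize q e (a (S n)) (qpow q n); clear; quat_ring. }
  assert (Hl : forall k x, is_series (fun m => qdot x (qconj (toeplitz a m k) * y m)%quat)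
    (qdot x (l k))).
  { intros k x.
    assert (H1 : is_series (fun m => qdot x (qconj (qpow q m * toeplitz a m k))%quat)
      (qdot x (qconj (qpow q k * w))%quat)).
    { apply (is_series_zero_prefix _ _ k).
      - intros m Hm; unfold toeplitz.
        destruct (Nat.leb_spec k (S m)).
        + replace (S m - k)%nat with 0%nat by lia; rewrite Ha0.
          generalize (qpow q m) x; clear; quat_ring.
        + generalize (qpow q m) x; clear; quat_ring.
      - replace (qdot x (qconj (qpow q k * w)))%quat
          with (qdot (qconj (qpow q k) * qconj x)%quat w)
          by (generalize w x (qpow q k); clear; quat_ring).
        apply (is_series_ext (fun n => qdot (qconj (qpow q k) * qconj x)%quat
          (qpow q n * a (S n))%quat)); [|apply Hg].
        intros n; unfold toeplitz; destruct (Nat.leb_spec k (S (k + n))); [|lia].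
        replace (S (k + n) - k)%nat with (S n) by lia; rewrite qpow_add.
        generalize (qpow q k) (qpow q n) (a (S n)) x; clear; quat_ring. }
    pose proof (is_series_plus _ _ _ _
      (is_series_at_0 (qdot x (qconj (toeplitz a 0 k) * u)%quat)) H1) as H.
    replace (qdot x (l k)) with (plus (qdot x (qconj (toeplitz a 0 k) * u)%quat)
      (qdot x (qconj (qpow q k * w))%quat)).
    2:{ unfold plus, l; simpl; generalize (toeplitz a 0 k) (qpow q k) w x u; clear; quat_ring. }
    revert H; apply is_series_ext; intros m; unfold plus, y; simpl.
    destruct (Nat.eqb_spec m 0) as [->|].
    - generalize (toeplitz a 0 k) (qpow q 0) x u; clear; quat_ring.
    - generalize (toeplitz a m k) (qpow q m) x; clear; quat_ring. }
  assert (Hgeom : forall (c : R) N, sum_n (fun k => if (k =? 0)%nat then c else Q ^ k) N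
    = c + Q / (1 - Q) - Q / (1 - Q) * Q ^ N).
  { intros c N; induction N as [|N IH]; [rewrite sum_O; simpl; real_ring|].
    rewrite sum_Sn, IH; simpl; unfold plus; simpl; field; lra. }
  assert (HQd : 0 < Q / (1 - Q)) by (apply Rdiv_lt_0_compat; [exact HQ|lra]).
  assert (HyB : forall N, sum_n (fun m => qdot (y m) (y m)) N
    <= qdot (u + 1)%quat (u + 1)%quat + Q / (1 - Q)).
  { intros N.
    rewrite (sum_n_ext _ (fun k => if (k =? 0)%nat then qdot (u + 1)%quat (u + 1)%quat
      else Q ^ k)).
    - rewrite Hgeom; pose proof (pow_lt Q N HQ); nra.
    - intros m; unfold y; destruct (Nat.eqb_spec m 0) as [->|].
      + simpl; generalize u; clear; quat_ring.
      + unfold Q; rewrite <- qdot_qpow; generalize (qpow q m); clear; quat_ring. }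
  assert (Hfin : forall K, sum_n (fun k => qdot (l k) (l k)) K
    <= qdot (u + 1)%quat (u + 1)%quat + Q / (1 - Q)).
  { intros K; apply (sum_sqr_weak_limit_le (fun N k =>
      qsum (fun m => (qconj (toeplitz a m k) * y m)%quat) N) l).
    - intros k x; apply (is_lim_seq_ext
        (sum_n (fun m => qdot x (qconj (toeplitz a m k) * y m)%quat))).
      + intros N; now rewrite qdot_qsum.
      + apply Hl.
    - intros N HKN; apply Rle_trans with (2 := HyB N).
      apply Rle_trans with (2 := toeplitz_adjoint_contraction a y f N Ha Hf Hball).
      apply (sum_n_ge0_mono (fun k => qdot
        (qsum (fun m => (qconj (toeplitz a m k) * y m)%quat) N)
        (qsum (fun m => (qconj (toeplitz a m k) * y m)%quat) N))); [|exact HKN].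
      intros n; apply qdot_sqr_ge0. }
  set (W := qdot w w) in *.
  set (L := qdot (qconj (a 1%nat) * u + qconj w)%quat (qconj (a 1%nat) * u + qconj w)%quat).
  (* [L] is the term [k = 0], where the entry is [a 1]. For [k >= 1] the entry in row 0 is zero, by
     [a 0 = 0] when [k = 1], which leaves [|q^k w|^2 = Q^k W]. *)
  assert (HL : forall K, L + W * (Q / (1 - Q) - Q / (1 - Q) * Q ^ K)
    <= qdot (u + 1)%quat (u + 1)%quat + Q / (1 - Q)).
  { intros K; apply Rle_trans with (2 := Hfin K); right.
    transitivity (L + W * (sum_n (fun k => if (k =? 0)%nat then 0 else Q ^ k) K));
      [rewrite Hgeom; ring|].
    induction K as [|K IH].
    - rewrite !sum_O; simpl; unfold L, l, toeplitz; simpl.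
      generalize (a 1%nat) w u; clear; quat_ring.
    - rewrite !sum_Sn, <- IH; unfold plus; simpl.
      rewrite Rmult_plus_distr_l, <- Rplus_assoc; f_equal.
      assert (Et : qconj (toeplitz a 0 (S K)) = quat_of_R 0).
      { unfold toeplitz; destruct K as [|K]; simpl; [rewrite Ha0|]; clear; quat_ring. }
      unfold l; rewrite Et; transitivity (W * (Q * qdot (qpow q K) (qpow q K)));
        [now rewrite qdot_qpow|].
      unfold W, Q; simpl qpow; generalize w q u (qpow q K); clear; quat_ring. }
  assert (Hlim : is_lim_seq (fun K => L + W * (Q / (1 - Q) - Q / (1 - Q) * Q ^ K))
    (L + W * (Q / (1 - Q) - 0))).
  { apply is_lim_seq_plus'; [apply is_lim_seq_const|].
    apply (is_lim_seq_scal_l _ W (Finite (Q / (1 - Q) - 0))).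
    apply is_lim_seq_minus'; [apply is_lim_seq_const|].
    apply is_lim_seq_geom_scal; rewrite Rabs_pos_eq; unfold Q in *; lra. }
  pose proof (is_lim_seq_le _ (fun _ => qdot (u + 1)%quat (u + 1)%quat + Q / (1 - Q))
    _ _ HL Hlim (is_lim_seq_const _)) as H; simpl in H; lra.
Qed.

(** [pick_form] bounds from below the quadratic expression [|u + 1|^2 - |conj(b) u + conj(w)|^2 = (1
    - |b|^2) |u|^2 + 2 <u, d> + 1 - |w|^2] with [d = 1 - b conj(w)]. Its minimizer
    [u = - d / (1 - |b|^2)] gives the sharpest inequality. *)
Lemma pick_inequality (a : nat -> quat) (f : quat -> quat) (q w : quat) :
  (forall n, qnorm (a n) <= 2) -> slice_series a f ->
  (forall q, unit_ball q -> unit_ball (f q)) -> a 0%nat = 0 -> unit_ball (a 1%nat) ->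
  unit_ball q -> f q = (q * w)%quat -> 0 < qdot q q ->
  let b := a 1%nat in
  qdot (w - b)%quat (w - b)%quat <=
  qdot q q * qdot (1 - w * qconj b)%quat (1 - w * qconj b)%quat.
Proof.
  intros Ha Hf Hball Ha0 Hb Hq Efq HQ b; fold b in Hb.
  apply unit_ball_dot in Hb; pose proof Hq as HQ1; apply unit_ball_dot in HQ1.
  set (d := (1 - b * qconj w)%quat).
  pose proof (pick_form a f q w ((- / (1 - qdot b b))%R * d)%quat
    Ha Hf Hball Ha0 Hq Efq HQ) as H.
  cbv zeta in H; fold b in H.
  set (k := - / (1 - qdot b b)) in *.
  set (Q := qdot q q) in *.
  assert (E1 : qdot (qconj b * (k * d) + qconj w)%quat (qconj b * (k * d) + qconj w)%quat
    = k ^ 2 * qdot b b * qdot d d + 2 * k * qdot d (b * qconj w)%quat + qdot w w).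
  { generalize d k w b; clear; quat_ring. }
  assert (E2 : qdot (k * d + 1)%quat (k * d + 1)%quat
    = k ^ 2 * qdot d d + 2 * k * qdot d 1 + 1).
  { generalize d k; clear; quat_ring. }
  assert (E3 : qdot d 1 - qdot d (b * qconj w)%quat = qdot d d)
    by (unfold d; generalize w b; clear; quat_ring).
  assert (E4 : qdot (1 - w * qconj b)%quat (1 - w * qconj b)%quat = qdot d d)
    by (unfold d; generalize w b; clear; quat_ring).
  (* The identity behind the pseudo-hyperbolic distance; it exchanges the Pick form for the
     contraction form of the inequality. *)
  assert (E5 : qdot (w - b)%quat (w - b)%quat
    = qdot d d - (1 - qdot b b) * (1 - qdot w w))
    by (unfold d; generalize w b; clear; quat_ring).
  rewrite E1, E2 in H; rewrite E4, E5.
  set (B := qdot b b) in *; set (D := qdot d d) in *; set (W := qdot w w) in *.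
  set (x := qdot d (b * qconj w)%quat) in *; set (z := qdot d 1) in *.
  assert (H1 : 0 <= (k ^ 2 * (1 - B) + 2 * k) * D + (1 - W) * (1 + Q / (1 - Q))).
  { assert (Ez : z = x + D) by lra; rewrite Ez in H; nra. }
  replace (k ^ 2 * (1 - B) + 2 * k) with (- / (1 - B)) in H1 by (unfold k; field; lra).
  replace (1 + Q / (1 - Q)) with (/ (1 - Q)) in H1 by (field; lra).
  assert (H2 : 0 <= (1 - B) * (1 - Q) * (- / (1 - B) * D + (1 - W) * / (1 - Q))).
  { apply Rmult_le_pos; [apply Rmult_le_pos; lra|exact H1]. }
  replace (_ * (_ + _)) with ((1 - B) * (1 - W) - (1 - Q) * D) in H2 by (field; lra).
  lra.
Qed.

(** * The coefficients [a_0], [a_1], and the inequality as a ball *)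

Lemma qdot_ext (p q : quat) : (forall e, qdot e p = qdot e q) -> p = q.
Proof.
  intros H; destruct p as [[[p0 p1] p2] p3], q as [[[q0 q1] q2] q3].
  pose proof (H (1, 0, 0, 0)) as H0; pose proof (H (0, 1, 0, 0)) as H1.
  pose proof (H (0, 0, 1, 0)) as H2; pose proof (H (0, 0, 0, 1)) as H3.
  unfold qdot in *; repeat f_equal; lra.
Qed.

Lemma is_derive_quat_unique (f : R -> quat) (x : R) (d d' : quat) :
  is_derive f x d -> is_derive f x d' -> d = d'.
Proof.
  intros H H'; apply qdot_ext; intros e.
  rewrite <- (is_derive_unique _ _ _ (is_derive_qdot e f x d H)).
  apply is_derive_unique, is_derive_qdot, H'.
Qed.

Lemma slice_series_coef0 (a : nat -> quat) (f : quat -> quat) :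
  slice_series a f -> f 0 = a 0%nat.
Proof.
  intros Hf; apply qdot_ext; intros e.
  assert (H0 : unit_ball 0) by (apply unit_ball_dot; unfold qdot, quat_of_R; lra).
  pose proof (slice_series_qpow a f 0 e Hf H0) as H.
  apply is_series_single in H.
  - rewrite H; simpl; generalize (a 0%nat); clear; quat_ring.
  - intros n Hn; destruct n as [|n]; [lia|]; simpl.
    generalize (qpow 0 n) (a (S n)); clear; quat_ring.
Qed.

Lemma half_sub_opp (q : quat) : ((1 / 2)%R * (q - - q))%quat = q.
Proof.
  destruct q as [[[a b] c] d]; unfold qsub, qopp, qadd, qmul, quat_of_R.
  repeat f_equal; field.
Qed.

(** Since the [y]-partial is [I] times the [x]-partial, the slice derivative is the derivative along
    the real axis, where the series is an ordinary real power series in each component. *)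
Lemma slice_series_coef1 (a : nat -> quat) (f : quat -> quat) (b : quat) :
  slice_regular f -> slice_series a f -> is_slice_derivative f 0 b -> a 1%nat = b.
Proof.
  intros Hreg Hf Hb; set (I := (0, 1, 0, 0) : quat).
  assert (HI : imag_unit I) by (apply imag_unit_intro; ring).
  destruct (slice_regular_cauchy_riemann f I Hreg HI) as (fx & Hx & Hy & _).
  assert (H0 : 0 ^ 2 + 0 ^ 2 < 1) by lra.
  specialize (Hx 0 0 H0); specialize (Hy 0 0 H0).
  assert (E0 : quat_of_R 0 = slice_point I 0 0) by (unfold I; clear; quat_ring).
  destruct (Hb I 0 0 HI E0) as (dx & dy & Hdx & Hdy & ->).
  rewrite (is_derive_quat_unique _ _ _ _ Hdx Hx), (is_derive_quat_unique _ _ _ _ Hdy Hy).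
  rewrite imag_unit_mul2 by exact HI.
  transitivity (fx (0, 0)); [|now rewrite half_sub_opp].
  apply qdot_ext; intros e.
  rewrite <- (is_derive_unique _ _ _ (is_derive_qdot e _ _ _ Hx)).
  symmetry; apply is_derive_unique.
  apply (power_series_derive_0 (fun n => qdot e (a n)) _ 1 Rlt_0_1).
  intros r Hr; pose proof (Hf e I r 0 HI Hr) as H.
  rewrite cos_0, sin_0, Rmult_1_r, Rmult_0_r in H; revert H.
  apply is_series_ext; intros n; rewrite Rmult_0_r, cos_0, sin_0; f_equal.
  generalize (a n); unfold I; clear; quat_ring.
Qed.

Lemma qdot_eq0 (q : quat) : qdot q q = 0 -> q = 0.
Proof.
  destruct q as [[[a b] c] d]; unfold qdot, quat_of_R; intros H.
  pose proof (Rle_0_sqr a); pose proof (Rle_0_sqr b); pose proof (Rle_0_sqr c);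
    pose proof (Rle_0_sqr d); unfold Rsqr in *.
  repeat f_equal; nra.
Qed.

(** A ball of Apollonius. The inequality is quadratic in [w] with leading coefficient
    [1 - |q|^2 |b|^2]; completing the square gives the centre [s b] with
    [s = (1 - |q|^2) / (1 - |q|^2 |b|^2)] and the radius [|q| (1 - |b|^2) / (1 - |q|^2 |b|^2)]. Left
    multiplication by [q] scales both to the stated ball. *)
Lemma pick_ball_iff (q b w : quat) : 0 < qdot q q < 1 -> qdot b b < 1 ->
  closed_ball (q * b * ((1 - qnorm q ^ 2) / (1 - qnorm (q * b) ^ 2))%R)%quat
    (qnorm q ^ 2 * (1 - qnorm b ^ 2) / (1 - qnorm (q * b)%quat ^ 2)) (q * w)%quat <->
  qdot (w - b)%quat (w - b)%quat <=
    qdot q q * qdot (1 - w * qconj b)%quat (1 - w * qconj b)%quat.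
Proof.
  intros HQ HB; rewrite !qnorm_sqr, qdot_mul.
  assert (HB0 := qdot_sqr_ge0 b).
  assert (E1 : forall s : R, qdot (q * w - q * b * s)%quat (q * w - q * b * s)%quat
    = qdot q q * (qdot w w - 2 * s * qdot w b + s ^ 2 * qdot b b)).
  { intros s; transitivity (qdot (q * (w - b * s))%quat (q * (w - b * s))%quat).
    - f_equal; clear; quat_ring.
    - rewrite qdot_mul; f_equal; clear; quat_ring. }
  assert (E2 : qdot (w - b)%quat (w - b)%quat = qdot w w - 2 * qdot w b + qdot b b)
    by (clear; quat_ring).
  assert (E3 : qdot (1 - w * qconj b)%quat (1 - w * qconj b)%quat
    = 1 - 2 * qdot w b + qdot b b * qdot w w) by (clear; quat_ring).
  rewrite E2, E3; unfold closed_ball.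
  set (s := (1 - qdot q q) / (1 - qdot q q * qdot b b)).
  set (Q := qdot q q) in *; set (B := qdot b b) in *; set (W := qdot w w) in *.
  assert (HD : 0 < 1 - Q * B) by nra.
  rewrite <- qnorm_le.
  2:{ apply Rmult_le_pos; [nra|left; now apply Rinv_0_lt_compat]. }
  rewrite E1; fold Q B W.
  assert (E4 : (1 - Q * B) * (Q * (W - 2 * s * qdot w b + s ^ 2 * B)
      - (Q * (1 - B) / (1 - Q * B)) ^ 2)
    = Q * (W - 2 * qdot w b + B - Q * (1 - 2 * qdot w b + B * W)))
    by (unfold s; field; lra).
  split; intros H.
  - assert (H1 : (1 - Q * B) * (Q * (W - 2 * s * qdot w b + s ^ 2 * B)
      - (Q * (1 - B) / (1 - Q * B)) ^ 2) <= 0) by nra.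
    rewrite E4 in H1; nra.
  - assert (H1 : Q * (W - 2 * qdot w b + B - Q * (1 - 2 * qdot w b + B * W)) <= 0) by nra.
    rewrite <- E4 in H1; nra.
Qed.

Lemma slice_regular_value_in_ball (q0 b : quat) (f : quat -> quat) :
  unit_ball q0 -> unit_ball b -> slice_regular f ->
  (forall q, unit_ball q -> unit_ball (f q)) -> f 0 = 0 -> is_slice_derivative f 0 b ->
  closed_ball (q0 * b * ((1 - qnorm q0 ^ 2) / (1 - qnorm (q0 * b) ^ 2))%R)%quat
    (qnorm q0 ^ 2 * (1 - qnorm b ^ 2) / (1 - qnorm (q0 * b)%quat ^ 2)) (f q0).
Proof.
  intros Hq Hb Hreg Hball H0 Hd.
  destruct (slice_regular_power_series f Hreg Hball) as (a & Ha & Hf).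
  pose proof (slice_series_coef0 a f Hf) as E0; rewrite H0 in E0.
  pose proof (slice_series_coef1 a f b Hreg Hf Hd) as E1.
  pose proof (qdot_sqr_ge0 q0) as HQ.
  pose proof Hq as HQ1; apply unit_ball_dot in HQ1.
  pose proof Hb as HB1; apply unit_ball_dot in HB1.
  destruct (Req_dec (qdot q0 q0) 0) as [Hz|Hz].
  - apply qdot_eq0 in Hz; subst q0; rewrite H0.
    unfold closed_ball; rewrite qnorm_0; right.
    transitivity (qnorm 0).
    + f_equal; generalize ((1 - 0 ^ 2) / (1 - qnorm (0 * b)%quat ^ 2)); clear; quat_ring.
    + rewrite qnorm_0; unfold Rdiv; ring.
  - set (w := ((/ qdot q0 q0)%R * qconj q0 * f q0)%quat).
    assert (Ew : f q0 = (q0 * w)%quat).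
    { transitivity ((/ qdot q0 q0 * qdot q0 q0)%R * f q0)%quat.
      - rewrite Rinv_l by exact Hz; generalize (f q0); clear; quat_ring.
      - unfold w; generalize (/ qdot q0 q0) (f q0); clear; quat_ring. }
    rewrite Ew; apply pick_ball_iff; [lra|exact HB1|].
    rewrite <- E1; apply (pick_inequality a f); trivial; try lra.
    + now symmetry.
    + now rewrite E1.
Qed.

(** * Attaining every value *)

Lemma cauchy_riemann_mult (u1 v1 p1 q1 u2 v2 p2 q2 : R -> R -> R) :
  cauchy_riemann u1 v1 p1 q1 -> cauchy_riemann u2 v2 p2 q2 ->
  cauchy_riemann
    (fun x y => u1 x y * u2 x y - v1 x y * v2 x y)
    (fun x y => u1 x y * v2 x y + v1 x y * u2 x y)
    (fun x y => p1 x y * u2 x y - q1 x y * v2 x y + (u1 x y * p2 x y - v1 x y * q2 x y))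
    (fun x y => p1 x y * v2 x y + q1 x y * u2 x y + (u1 x y * q2 x y + v1 x y * p2 x y)).
Proof.
  intros H1 H2 x y Hxy.
  destruct (cauchy_riemann_continuous _ _ _ _ x y H1 Hxy) as [Cu1 Cv1].
  destruct (cauchy_riemann_continuous _ _ _ _ x y H2 Hxy) as [Cu2 Cv2].
  destruct (H1 x y Hxy) as [[A1 A2] [[A3 A4] [A5 A6]]].
  destruct (H2 x y Hxy) as [[B1 B2] [[B3 B4] [B5 B6]]].
  assert (Hm : forall (f g : R -> R) t df dg, is_derive f t df -> is_derive g t dg ->
    is_derive (fun t => f t * g t) t (df * g t + f t * dg)).
  { intros f g t df dg Hf Hg; exact (is_derive_mult f g t df dg Hf Hg Rmult_comm). }
  assert (Hp : forall (f g : R -> R) t df dg d, is_derive f t df -> is_derive g t dg ->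
    d = df + dg -> is_derive (fun t => f t + g t) t d).
  { intros f g t df dg d Hf Hg ->; exact (is_derive_plus f g t df dg Hf Hg). }
  assert (Hs : forall (f g : R -> R) t df dg d, is_derive f t df -> is_derive g t dg ->
    d = df - dg -> is_derive (fun t => f t - g t) t d).
  { intros f g t df dg d Hf Hg ->; exact (is_derive_minus f g t df dg Hf Hg). }
  split; [split|split; [split|split]].
  - apply (Hs _ _ _ _ _ _ (Hm _ _ _ _ _ A1 B1) (Hm _ _ _ _ _ A3 B3)); ring.
  - apply (Hs _ _ _ _ _ _ (Hm _ _ _ _ _ A2 B2) (Hm _ _ _ _ _ A4 B4)); ring.
  - apply (Hp _ _ _ _ _ _ (Hm _ _ _ _ _ A1 B3) (Hm _ _ _ _ _ A3 B1)); ring.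
  - apply (Hp _ _ _ _ _ _ (Hm _ _ _ _ _ A2 B4) (Hm _ _ _ _ _ A4 B2)); ring.
  - apply continuity_2d_pt_plus; apply continuity_2d_pt_minus;
      now apply continuity_2d_pt_mult.
  - apply continuity_2d_pt_plus; apply continuity_2d_pt_plus;
      now apply continuity_2d_pt_mult.
Qed.

(** The derivative of [1 / (u + iv)] is [- (p + iq) (U + iV)^2]; written through [U] and [V], its
    continuity follows from theirs. *)
Lemma cauchy_riemann_inv (u v p q : R -> R -> R) :
  cauchy_riemann u v p q ->
  (forall x y, x ^ 2 + y ^ 2 < 1 -> u x y ^ 2 + v x y ^ 2 <> 0) ->
  let U x y := u x y / (u x y ^ 2 + v x y ^ 2) in
  let V x y := - v x y / (u x y ^ 2 + v x y ^ 2) in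
  cauchy_riemann U V
    (fun x y => - (p x y * (U x y * U x y - V x y * V x y) - q x y * (2 * (U x y * V x y))))
    (fun x y => - (p x y * (2 * (U x y * V x y)) + q x y * (U x y * U x y - V x y * V x y))).
Proof.
  intros H HN U V x y Hxy; specialize (HN x y Hxy).
  destruct (cauchy_riemann_continuous _ _ _ _ x y H Hxy) as [Cu Cv].
  destruct (H x y Hxy) as [[A1 A2] [[A3 A4] [A5 A6]]].
  assert (HD : forall (f g : R -> R) t df dg, is_derive f t df -> is_derive g t dg ->
    f t ^ 2 + g t ^ 2 <> 0 ->
    is_derive (fun t => f t / (f t ^ 2 + g t ^ 2)) t
      ((df * (g t ^ 2 - f t ^ 2) - 2 * f t * g t * dg) / (f t ^ 2 + g t ^ 2) ^ 2) /\
    is_derive (fun t => - g t / (f t ^ 2 + g t ^ 2)) t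
      ((2 * f t * g t * df - dg * (f t ^ 2 - g t ^ 2)) / (f t ^ 2 + g t ^ 2) ^ 2)).
  { intros f g t df dg Hf Hg Hn.
    split; auto_derive;
      try (repeat split; trivial; (eexists; eassumption) || (simpl in Hn; lra));
      change (Derive (fun x => f x) t) with (Derive f t);
      change (Derive (fun x => g x) t) with (Derive g t);
      rewrite (is_derive_unique _ _ _ Hf), (is_derive_unique _ _ _ Hg);
      field; simpl in *; lra. }
  destruct (HD _ _ _ _ _ A1 A3 HN) as [D1 D2].
  destruct (HD _ _ _ _ _ A2 A4 HN) as [D3 D4].
  assert (CN : continuity_2d_pt (fun x y => / (u x y ^ 2 + v x y ^ 2)) x y).
  { apply continuity_2d_pt_inv; [|exact HN].
    apply continuity_2d_pt_plus; simpl; repeat apply continuity_2d_pt_mult; trivial;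
      apply continuity_2d_pt_const. }
  assert (CU : continuity_2d_pt U x y) by now apply continuity_2d_pt_mult.
  assert (CV : continuity_2d_pt V x y)
    by (apply continuity_2d_pt_mult; trivial; now apply continuity_2d_pt_opp).
  assert (C1 := continuity_2d_pt_minus _ _ _ _ (continuity_2d_pt_mult _ _ _ _ CU CU)
    (continuity_2d_pt_mult _ _ _ _ CV CV)).
  assert (C2 := continuity_2d_pt_mult _ _ _ _ (continuity_2d_pt_const x y 2)
    (continuity_2d_pt_mult _ _ _ _ CU CV)).
  split; [split|split; [split|split]].
  - refine (eq_ind _ _ D1 _ _); unfold U, V; field; exact HN.
  - refine (eq_ind _ _ D3 _ _); unfold U, V; field; exact HN.
  - refine (eq_ind _ _ D2 _ _); unfold U, V; field; exact HN.
  - refine (eq_ind _ _ D4 _ _); unfold U, V; field; exact HN.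
  - exact (continuity_2d_pt_opp _ _ _ (continuity_2d_pt_minus _ _ _ _
      (continuity_2d_pt_mult _ _ _ _ A5 C1) (continuity_2d_pt_mult _ _ _ _ A6 C2))).
  - exact (continuity_2d_pt_opp _ _ _ (continuity_2d_pt_plus _ _ _ _
      (continuity_2d_pt_mult _ _ _ _ A5 C2) (continuity_2d_pt_mult _ _ _ _ A6 C1))).
Qed.

(* [F I x y] is the value at [x + y I], and [Fx] the partial derivative in [x]. *)
Definition slice_holomorphic (F Fx : quat -> R -> R -> quat) : Prop :=
  forall I x y, imag_unit I -> x ^ 2 + y ^ 2 < 1 ->
  is_derive (fun t : R => F I t y) x (Fx I x y) /\
  is_derive (fun t : R => F I x t) y (I * Fx I x y)%quat /\
  continuous (fun z : R * R => Fx I (fst z) (snd z)) (x, y) /\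
  continuous (fun z : R * R => (I * Fx I (fst z) (snd z))%quat) (x, y).

Lemma plus_quat (p q : quat) : plus p q = (p + q)%quat.
Proof. destruct p as [[[a b] c] d], q as [[[a' b'] c'] d']; reflexivity. Qed.

Lemma scal_quat (k : R) (q : quat) : scal k q = (k * q)%quat.
Proof.
  destruct q as [[[a b] c] d]; transitivity ((k * a, k * b, k * c, k * d) : quat);
    [reflexivity|clear; quat_ring].
Qed.

Lemma slice_point_mul_scal (I c : quat) (u v : R) :
  plus (scal u c) (scal v (I * c)%quat) = (slice_point I u v * c)%quat.
Proof. rewrite plus_quat, !scal_quat; quat_ring. Qed.

Lemma imag_unit_mul_slice_point (I c : quat) (u v : R) : imag_unit I ->
  (I * (slice_point I u v * c) = slice_point I (- v) u * c)%quat.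
Proof.
  intros HI; rewrite qmul_assoc; f_equal.
  transitivity (u * I + v * (I * I))%quat; [|rewrite HI]; clear; quat_ring.
Qed.

(** Left multiplication by [I] commutes with right multiplication by the constant [c], so the
    Cauchy-Riemann equations of [u + iv] pass to every slice at once. *)
Lemma slice_holomorphic_scal (u v p q : R -> R -> R) (c : quat) :
  cauchy_riemann u v p q ->
  slice_holomorphic (fun I x y => slice_point I (u x y) (v x y) * c)%quat
    (fun I x y => slice_point I (p x y) (q x y) * c)%quat.
Proof.
  intros H I x y HI Hxy; destruct (H x y Hxy) as [[A1 A2] [[A3 A4] [A5 A6]]].
  assert (HD : forall (f g : R -> R) t df dg, is_derive f t df -> is_derive g t dg ->
    is_derive (fun t : R => (slice_point I (f t) (g t) * c)%quat) t
      (slice_point I df dg * c)%quat).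
  { intros f g t df dg Hf Hg; rewrite <- slice_point_mul_scal.
    apply (is_derive_ext (fun t => plus (scal (f t) c) (scal (g t) (I * c)%quat))).
    - intros s; apply slice_point_mul_scal.
    - exact (is_derive_plus _ _ _ _ _ (is_derive_scal_l f t df c Hf)
        (is_derive_scal_l g t dg (I * c)%quat Hg)). }
  assert (HC : forall f g : R * R -> R, continuous f (x, y) -> continuous g (x, y) ->
    continuous (fun z : R * R => (slice_point I (f z) (g z) * c)%quat) (x, y)).
  { intros f g Hf Hg.
    apply (continuous_ext (fun z : R * R => plus (scal (f z) c) (scal (g z) (I * c)%quat))).
    - intros z; apply slice_point_mul_scal.
    - exact (continuous_plus _ _ _ (continuous_scal_l f c (x, y) Hf)
        (continuous_scal_l g (I * c)%quat (x, y) Hg)). }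
  apply continuity_2d_pt_filterlim in A5; apply continuity_2d_pt_filterlim in A6.
  split; [|split; [|split]].
  - exact (HD _ _ _ _ _ A1 A3).
  - rewrite imag_unit_mul_slice_point by exact HI; exact (HD _ _ _ _ _ A2 A4).
  - exact (HC _ _ A5 A6).
  - eapply continuous_ext;
      [intros z; symmetry; now apply imag_unit_mul_slice_point|].
    apply (HC (fun z => - q (fst z) (snd z)) (fun z => p (fst z) (snd z)));
      [now apply (continuous_opp (V := R_NormedModule))|exact A5].
Qed.

Lemma slice_holomorphic_plus (F Fx G Gx : quat -> R -> R -> quat) :
  slice_holomorphic F Fx -> slice_holomorphic G Gx ->
  slice_holomorphic (fun I x y => F I x y + G I x y)%quat
    (fun I x y => Fx I x y + Gx I x y)%quat.
Proof.
  intros HF HG I x y HI Hxy.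
  destruct (HF I x y HI Hxy) as (F1 & F2 & F3 & F4).
  destruct (HG I x y HI Hxy) as (G1 & G2 & G3 & G4).
  assert (E : forall s t, (I * (Fx I s t + Gx I s t))%quat
    = plus (I * Fx I s t)%quat (I * Gx I s t)%quat).
  { intros s t; rewrite plus_quat; generalize (Fx I s t) (Gx I s t); clear; quat_ring. }
  split; [|split; [|split]].
  - rewrite <- plus_quat; eapply is_derive_ext; [intros t; apply plus_quat|].
    exact (is_derive_plus _ _ _ _ _ F1 G1).
  - rewrite E; eapply is_derive_ext; [intros t; apply plus_quat|].
    exact (is_derive_plus _ _ _ _ _ F2 G2).
  - eapply continuous_ext; [intros z; apply plus_quat|].
    exact (continuous_plus _ _ _ F3 G3).
  - eapply continuous_ext; [intros z; symmetry; apply E|].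
    exact (continuous_plus _ _ _ F4 G4).
Qed.

Lemma slice_holomorphic_partials (f : quat -> quat) (F Fx : quat -> R -> R -> quat)
  (I : quat) (x y : R) :
  slice_holomorphic F Fx ->
  (forall I x y, imag_unit I -> x ^ 2 + y ^ 2 < 1 -> f (slice_point I x y) = F I x y) ->
  imag_unit I -> x ^ 2 + y ^ 2 < 1 ->
  is_partial_x f I x y (Fx I x y) /\ is_partial_y f I x y (I * Fx I x y)%quat.
Proof.
  intros HF Hf HI Hxy; destruct (HF I x y HI Hxy) as (F1 & F2 & _).
  destruct (locally_2d_disc x y Hxy) as [d Hd].
  assert (H0 : forall s, Rabs (s - s) < d)
    by (intros s; rewrite Rminus_diag, Rabs_R0; apply cond_pos).
  split.
  - apply (is_derive_ext_loc (fun t => F I t y)); [|exact F1].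
    exists d; intros t Ht; symmetry; apply Hf; [exact HI|]; now apply Hd.
  - apply (is_derive_ext_loc (fun t => F I x t)); [|exact F2].
    exists d; intros t Ht; symmetry; apply Hf; [exact HI|]; now apply Hd.
Qed.

Lemma slice_holomorphic_regular (f : quat -> quat) (F Fx : quat -> R -> R -> quat) :
  slice_holomorphic F Fx ->
  (forall I x y, imag_unit I -> x ^ 2 + y ^ 2 < 1 -> f (slice_point I x y) = F I x y) ->
  slice_regular f.
Proof.
  intros HF Hf I HI.
  exists (fun z => Fx I (fst z) (snd z)), (fun z => (I * Fx I (fst z) (snd z))%quat).
  intros x y Hxy; apply slice_point_unit_ball in Hxy; [|exact HI].
  destruct (slice_holomorphic_partials f F Fx I x y HF Hf HI Hxy) as [Hx Hy].
  destruct (HF I x y HI Hxy) as (_ & _ & Hc & Hc').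
  split; [exact Hx|split; [exact Hy|split; [exact Hc|split; [exact Hc'|]]]].
  simpl fst; simpl snd; rewrite imag_unit_mul2 by exact HI.
  generalize (Fx I x y); clear; quat_ring.
Qed.

(** * The extremal function *)

Definition qinv (p : quat) : quat := ((/ qdot p p)%R * qconj p)%quat.

Lemma qinv_r (p : quat) : qdot p p <> 0 -> (p * qinv p)%quat = 1.
Proof.
  intros H; transitivity (quat_of_R (/ qdot p p * qdot p p)); [|now rewrite Rinv_l].
  unfold qinv; generalize (/ qdot p p); clear; quat_ring.
Qed.

Lemma slice_point_mul (I : quat) (u v u' v' : R) : imag_unit I ->
  (slice_point I u v * slice_point I u' v')%quat
  = slice_point I (u * u' - v * v') (u * v' + v * u').
Proof.
  intros HI.
  transitivity ((u * u')%R + (u * v' + v * u')%R * I + (v * v')%R * (I * I))%quat;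
    [|rewrite HI]; clear; quat_ring.
Qed.

Lemma qinv_slice_point (I : quat) (u v : R) : imag_unit I -> u ^ 2 + v ^ 2 <> 0 ->
  qinv (slice_point I u v) = slice_point I (u / (u ^ 2 + v ^ 2)) (- v / (u ^ 2 + v ^ 2)).
Proof.
  intros HI Hn; unfold qinv; rewrite qdot_slice_point by exact HI.
  destruct (imag_unit_spec I HI) as (i1 & i2 & i3 & -> & _).
  unfold Rdiv; generalize (/ (u ^ 2 + v ^ 2)); clear; quat_ring.
Qed.

(** The polynomial [1 + 2 (Re e) z + |e|^2 z^2] factors over the complex numbers as
    [(1 + c z) (1 + conj(c) z)] with [|c| = |e| < 1]; on the disc both factors have positive real
    part. *)
Lemma real_quadratic_neq0 (e : quat) (x y : R) : qdot e e < 1 -> x ^ 2 + y ^ 2 < 1 ->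
  (1 + 2 * qdot 1 e * x + qdot e e * (x * x - y * y)) ^ 2
  + (2 * qdot 1 e * y + qdot e e * (2 * x * y)) ^ 2 <> 0.
Proof.
  destruct e as [[[t e1] e2] e3]; intros Hn Hxy.
  set (tau := sqrt (e1 ^ 2 + e2 ^ 2 + e3 ^ 2)).
  assert (Htau : tau ^ 2 = e1 ^ 2 + e2 ^ 2 + e3 ^ 2) by (apply pow2_sqrt; nra).
  assert (En : qdot (t, e1, e2, e3) (t, e1, e2, e3) = t ^ 2 + tau ^ 2)
    by (rewrite Htau; unfold qdot; ring).
  assert (Et : qdot 1 (t, e1, e2, e3) = t) by (unfold qdot, quat_of_R; ring).
  rewrite En in *; rewrite Et; clearbody tau; clear Htau En Et e1 e2 e3.
  (* [1 + 2 t z + n z^2 = (1 + (t + i tau) z) (1 + (t - i tau) z)] *)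
  replace (_ + _) with
    (((1 + (t * x - tau * y)) ^ 2 + (t * y + tau * x) ^ 2)
     * ((1 + (t * x + tau * y)) ^ 2 + (t * y - tau * x) ^ 2)) by ring.
  assert (Hlt : (t ^ 2 + tau ^ 2) * (x ^ 2 + y ^ 2) < 1).
  { pose proof (pow2_ge_0 t); pose proof (pow2_ge_0 tau).
    assert (Hle : 0 <= (t ^ 2 + tau ^ 2) * (1 - (x ^ 2 + y ^ 2))) by (apply Rmult_le_pos; lra).
    lra. }
  assert (H1 : (t * x - tau * y) ^ 2 < 1) by (pose proof (pow2_ge_0 (t * y + tau * x)); nra).
  assert (H2 : (t * x + tau * y) ^ 2 < 1) by (pose proof (pow2_ge_0 (t * y - tau * x)); nra).
  assert (P1 : 0 < 1 + (t * x - tau * y)) by nra.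
  assert (P2 : 0 < 1 + (t * x + tau * y)) by nra.
  apply Rgt_not_eq, Rmult_lt_0_compat;
    (apply Rplus_lt_le_0_compat; [now apply pow_lt|apply pow2_ge_0]).
Qed.

(* [g] is the regular quotient of [q a + b] by [1 + q a conj(b)] in closed form.  With
   [e = conj(b) a], the relation [e^2 = 2 (Re e) e - |e|^2] makes
   [1 + 2 q Re e + q^2 |e|^2] a multiple of the operator [x |-> x + q x e]. *)
Lemma extremal_function (a b : quat) : qdot a a <= 1 -> qdot b b < 1 ->
  exists g : quat -> quat,
    slice_regular (fun q => (q * g q)%quat) /\
    is_slice_derivative (fun q => (q * g q)%quat) 0 b /\
    forall q, unit_ball q -> (g q + q * g q * (qconj b * a) = q * a + b)%quat.
Proof.
  intros Ha Hb; set (e := (qconj b * a)%quat).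
  assert (He : qdot e e < 1).
  { unfold e; rewrite qdot_mul.
    rewrite qdot_conj; pose proof (qdot_sqr_ge0 a); pose proof (qdot_sqr_ge0 b); nra. }
  clearbody e.
  set (t := qdot 1 e); set (n := qdot e e) in *.
  set (D := fun q : quat => (1 + (2 * t)%R * q + n * (q * q))%quat).
  (* With [conj(e) = 2 t - e], the polynomial [b + q A + q^2 C] is the regular product of [b + q a]
     and [1 + q conj(e)], and [D] is the regular product of [1 + q e] and [1 + q conj(e)]. *)
  set (A := (a + (2 * t)%R * b - b * e)%quat).
  set (C := ((2 * t)%R * a - a * e)%quat).
  set (g := fun q => (qinv (D q) * (b + q * A + q * q * C))%quat); exists g.
  set (d1 := fun x y => 1 + 2 * t * x + n * (x * x - y * y)).
  set (d2 := fun x y => 2 * t * y + n * (2 * x * y)).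
  assert (HDs : forall I x y, imag_unit I ->
    D (slice_point I x y) = slice_point I (d1 x y) (d2 x y)).
  { intros I x y HI; unfold D; rewrite slice_point_mul by exact HI.
    unfold d1, d2; clear; quat_ring. }
  assert (Hd : forall x y, x ^ 2 + y ^ 2 < 1 -> d1 x y ^ 2 + d2 x y ^ 2 <> 0)
    by (intros x y Hxy; now apply real_quadratic_neq0).
  assert (CRd : cauchy_riemann d1 d2 (fun x y => 2 * t + 2 * n * x) (fun x y => 2 * n * y)).
  { intros x y _; unfold d1, d2; split; [split|split; [split|split]];
      try (auto_derive; [trivial|ring]);
      repeat (apply continuity_2d_pt_plus || apply continuity_2d_pt_mult
        || apply continuity_2d_pt_const || apply continuity_2d_pt_id1
        || apply continuity_2d_pt_id2). }
  assert (CRz : cauchy_riemann (fun x _ => x) (fun _ y => y) (fun _ _ => 1) (fun _ _ => 0)).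
  { intros x y _; split; [split|split; [split|split]];
      try (auto_derive; [trivial|ring]); apply continuity_2d_pt_const. }
  pose proof (cauchy_riemann_inv _ _ _ _ CRd Hd) as CRi; cbv zeta in CRi.
  set (U := fun x y => d1 x y / (d1 x y ^ 2 + d2 x y ^ 2)) in *.
  set (V := fun x y => - d2 x y / (d1 x y ^ 2 + d2 x y ^ 2)) in *.
  assert (EU : U 0 0 = 1).
  { unfold U; replace (d1 0 0) with 1 by (unfold d1; ring).
    replace (d2 0 0) with 0 by (unfold d2; ring); field. }
  assert (EV : V 0 0 = 0).
  { unfold V; replace (d2 0 0) with 0 by (unfold d2; ring); unfold Rdiv; ring. }
  (* The functions [z / D], [z^2 / D], [z^3 / D], which multiply [b], [A], [C] in [q g(q)]; [D] has
     real coefficients, so each slice is mapped into its own plane. *)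
  pose proof (cauchy_riemann_mult _ _ _ _ _ _ _ _ CRz CRi) as CR1.
  pose proof (cauchy_riemann_mult _ _ _ _ _ _ _ _ CRz CR1) as CR2.
  pose proof (cauchy_riemann_mult _ _ _ _ _ _ _ _ CRz CR2) as CR3.
  pose proof (slice_holomorphic_plus _ _ _ _ (slice_holomorphic_plus _ _ _ _
    (slice_holomorphic_scal _ _ _ _ b CR1) (slice_holomorphic_scal _ _ _ _ A CR2))
    (slice_holomorphic_scal _ _ _ _ C CR3)) as HF.
  clear CRz CRd CRi CR1 CR2 CR3.
  match type of HF with slice_holomorphic ?f ?fx => set (F := f) in HF; set (Fx := fx) in HF end.
  assert (Hf : forall I x y, imag_unit I -> x ^ 2 + y ^ 2 < 1 ->
    (slice_point I x y * g (slice_point I x y))%quat = F I x y).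
  { intros I x y HI Hxy; unfold g, F.
    rewrite HDs, qinv_slice_point by auto.
    change (d1 x y / (d1 x y ^ 2 + d2 x y ^ 2)) with (U x y).
    change (- d2 x y / (d1 x y ^ 2 + d2 x y ^ 2)) with (V x y).
    rewrite <- !slice_point_mul by exact HI.
    assert (Ecomm : (slice_point I (U x y) (V x y) * slice_point I x y)%quat
      = (slice_point I x y * slice_point I (U x y) (V x y))%quat).
    { rewrite !slice_point_mul by exact HI; f_equal; ring. }
    revert Ecomm; generalize (slice_point I x y) (slice_point I (U x y) (V x y)) A C.
    clear; intros z w A C E.
    transitivity (z * w * b + z * (w * z) * A + z * (w * z) * z * C)%quat.
    - clear E; quat_ring.
    - assert (E3 : (z * (z * w) * z = z * (z * (z * w)))%quat)
        by (now rewrite <- !qmul_assoc, E).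
      now rewrite E, E3. }
  split; [|split].
  - now apply (slice_holomorphic_regular _ F Fx).
  - intros I x y HI E.
    assert (Exy : x ^ 2 + y ^ 2 = 0).
    { rewrite <- (qdot_slice_point I x y HI), <- E; unfold qdot, quat_of_R; ring. }
    assert (x = 0) by nra; assert (y = 0) by nra; subst x y; clear E Exy.
    assert (H00 : 0 ^ 2 + 0 ^ 2 < 1) by lra.
    destruct (slice_holomorphic_partials (fun q => q * g q)%quat F Fx I 0 0 HF Hf HI H00)
      as [Hx Hy].
    exists (Fx I 0 0), (I * Fx I 0 0)%quat; split; [exact Hx|split; [exact Hy|]].
    rewrite imag_unit_mul2, half_sub_opp by exact HI.
    unfold Fx; rewrite EU, EV; clear; quat_ring.
  - intros q Hq.
    assert (HDq : qdot (D q) (D q) <> 0).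
    { destruct (quat_polar q) as (I & r & phi & HI & _ & ->).
      apply slice_point_unit_ball in Hq; [|exact HI].
      rewrite HDs, qdot_slice_point by exact HI; now apply Hd. }
    set (h := (b + q * A + q * q * C)%quat).
    assert (EDg : (D q * g q)%quat = h).
    { unfold g; fold h; rewrite qmul_assoc, qinv_r by exact HDq; clear; quat_ring. }
    assert (EDq : (D q * q = q * D q)%quat) by (unfold D; clear; quat_ring).
    assert (Eh : (h + q * h * e = D q * (q * a + b))%quat).
    { unfold h.
      transitivity (b + q * A + (q * q) * C + (q * b + (q * q) * A + (q * q * q) * C) * e)%quat.
      - clear; quat_ring.
      - transitivity (b + q * (A + b * e) + (q * q) * (C + A * e) + (q * q * q) * (C * e))%quat;
          [clear; quat_ring|].
        assert (E1 : (A + b * e = a + (2 * t)%R * b)%quat) by (unfold A; clear; quat_ring).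
        assert (E2 : (C + A * e = (2 * t)%R * a + n * b)%quat)
          by (unfold C, A, t, n; clear; quat_ring).
        assert (E3 : (C * e = n * a)%quat) by (unfold C, t, n; clear; quat_ring).
        rewrite E1, E2, E3; unfold D; clear; quat_ring. }
    (* [D q] commutes with [q], so the equation may be checked after left multiplication by [D q],
       which is then cancelled. *)
    assert (Ez : (D q * (g q + q * g q * e - (q * a + b)) = 0)%quat).
    { transitivity (D q * g q + (D q * q) * g q * e - D q * (q * a + b))%quat;
        [generalize (D q) (g q); clear; quat_ring|].
      rewrite EDq; transitivity (D q * g q + q * (D q * g q) * e - D q * (q * a + b))%quat;
        [generalize (D q) (g q); clear; quat_ring|].
      rewrite EDg, Eh; generalize (D q * (q * a + b))%quat; clear; quat_ring. }
    assert (Ezero : (g q + q * g q * e - (q * a + b))%quat = 0).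
    { apply qdot_eq0.
      apply (Rmult_eq_reg_l (qdot (D q) (D q))); [|exact HDq].
      rewrite <- qdot_mul, Ez, Rmult_0_r; unfold qdot, quat_of_R; ring. }
    transitivity (g q + q * g q * e - (q * a + b) + (q * a + b))%quat;
      [generalize (g q + q * g q * e)%quat (q * a + b)%quat; clear; quat_ring|].
    rewrite Ezero; clear; quat_ring.
Qed.

(** The equation reads [x - b = q d a], so [|x - b|^2 <= |q|^2 |d|^2], while [|x - b|^2 = |d|^2 - (1
    - |b|^2) (1 - |x|^2)]. If [|x| >= 1], these force [d = 0] and then [x = b], against
    [|b| < 1]. *)
Lemma mobius_equation_unit_ball (a b q x : quat) : qdot a a <= 1 -> qdot b b < 1 ->
  qdot q q < 1 -> (x + q * x * (qconj b * a) = q * a + b)%quat -> qdot x x < 1.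
Proof.
  intros Ha Hb Hq E.
  set (d := (1 - x * qconj b)%quat).
  assert (E1 : (x - b = q * (d * a))%quat).
  { transitivity (x + q * x * (qconj b * a) - (q * x * (qconj b * a) + b))%quat.
    - generalize (q * x * (qconj b * a))%quat; clear; quat_ring.
    - rewrite E; unfold d; clear; quat_ring. }
  assert (E2 : qdot (x - b)%quat (x - b)%quat = qdot d d - (1 - qdot b b) * (1 - qdot x x))
    by (unfold d; clear; quat_ring).
  pose proof (qdot_sqr_ge0 q) as Hq0; pose proof (qdot_sqr_ge0 d) as Hd0.
  pose proof (qdot_sqr_ge0 a) as Ha0.
  assert (H1 : qdot (x - b)%quat (x - b)%quat <= qdot q q * qdot d d).
  { rewrite E1, !qdot_mul, <- Rmult_assoc.
    rewrite <- (Rmult_1_r (qdot q q * qdot d d)) at 2.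
    apply Rmult_le_compat_l; [now apply Rmult_le_pos|exact Ha]. }
  pose proof (qdot_sqr_ge0 (x - b)%quat) as Hxb.
  apply Rnot_le_lt; intros Hx.
  assert (HBW : 0 <= (1 - qdot b b) * (qdot x x - 1)) by (apply Rmult_le_pos; lra).
  assert (Hd : qdot d d = 0) by nra.
  assert (Hz : qdot (x - b)%quat (x - b)%quat = 0) by (rewrite Hd in H1; lra).
  apply qdot_eq0 in Hz.
  assert (Exb : x = b).
  { transitivity (x - b + b)%quat; [clear; quat_ring|rewrite Hz; clear; quat_ring]. }
  subst x; lra.
Qed.

(** The map sending [x] to [v - q x e] contracts by the factor [|q| |e| < 1]. *)
Lemma mobius_equation_unique (e q v x y : quat) : qdot e e < 1 -> qdot q q < 1 ->
  (x + q * x * e = v)%quat -> (y + q * y * e = v)%quat -> x = y.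
Proof.
  intros He Hq Hx Hy.
  assert (E : (x - y = - (q * (x - y) * e))%quat).
  { transitivity (x + q * x * e - (y + q * y * e) - q * (x - y) * e)%quat; [clear; quat_ring|].
    rewrite Hx, Hy; generalize (q * (x - y) * e)%quat; clear; quat_ring. }
  assert (E2 : qdot (x - y)%quat (x - y)%quat
    = qdot q q * qdot (x - y)%quat (x - y)%quat * qdot e e).
  { rewrite E at 1 2.
    transitivity (qdot (q * (x - y) * e)%quat (q * (x - y) * e)%quat);
      [generalize (q * (x - y) * e)%quat; clear; quat_ring|].
    now rewrite !qdot_mul. }
  pose proof (qdot_sqr_ge0 (x - y)%quat) as H0; pose proof (qdot_sqr_ge0 e).
  pose proof (qdot_sqr_ge0 q).
  assert (Hz : qdot (x - y)%quat (x - y)%quat = 0).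
  { assert (Hqe : qdot q q * qdot e e < 1) by nra.
    assert (H3 : qdot (x - y)%quat (x - y)%quat * (1 - qdot q q * qdot e e) = 0) by lra.
    apply Rmult_integral in H3; destruct H3; [trivial|lra]. }
  apply qdot_eq0 in Hz.
  transitivity (x - y + y)%quat; [clear; quat_ring|rewrite Hz; clear; quat_ring].
Qed.

Lemma ball_value_attained (q0 b w : quat) : unit_ball q0 -> unit_ball b ->
  closed_ball (q0 * b * ((1 - qnorm q0 ^ 2) / (1 - qnorm (q0 * b) ^ 2))%R)%quat
    (qnorm q0 ^ 2 * (1 - qnorm b ^ 2) / (1 - qnorm (q0 * b)%quat ^ 2)) w ->
  exists f : quat -> quat,
    slice_regular f /\ (forall q, unit_ball q -> unit_ball (f q)) /\
    f 0 = 0 /\ is_slice_derivative f 0 b /\ w = f q0.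
Proof.
  intros Hq Hb Hw.
  apply unit_ball_dot in Hq; apply unit_ball_dot in Hb.
  (* Quantifying over every solution [x] lets this be applied to [g q0], known only through the
     equation. *)
  assert (Hcoef : exists a, qdot a a <= 1 /\ forall x,
    (x + q0 * x * (qconj b * a) = q0 * a + b)%quat -> (q0 * x)%quat = w).
  { destruct (Req_dec (qdot q0 q0) 0) as [Hz|Hz].
    - exists 0; split; [unfold qdot, quat_of_R; lra|]; intros x _.
      apply qdot_eq0 in Hz; subst q0.
      transitivity (quat_of_R 0); [clear; quat_ring|]; symmetry; apply qdot_eq0.
      rewrite <- qnorm_sqr; unfold closed_ball in Hw.
      rewrite qnorm_0 in Hw; unfold Rdiv in Hw at 2.
      replace (0 ^ 2 * (1 - qnorm b ^ 2) * / (1 - qnorm (0 * b)%quat ^ 2)) with 0 in Hw by ring.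
      match type of Hw with qnorm ?p <= 0 => replace p with w in Hw end.
      + pose proof (qnorm_ge0 w); replace (qnorm w) with 0 by lra; ring.
      + generalize ((1 - 0 ^ 2) / (1 - qnorm (0 * b)%quat ^ 2)); clear; quat_ring.
    - pose proof (qdot_sqr_ge0 q0) as HQ0; assert (HQ : 0 < qdot q0 q0 < 1) by lra.
      set (w1 := (qinv q0 * w)%quat).
      assert (Ew : w = (q0 * w1)%quat).
      { unfold w1; rewrite qmul_assoc, qinv_r by exact Hz; clear; quat_ring. }
      rewrite Ew in Hw; apply pick_ball_iff in Hw; trivial.
      set (d := (1 - w1 * qconj b)%quat) in *.
      (* If [d] were zero, the inequality would give [w1 = b], and then [d = 1 - |b|^2] is not
         zero. *)
      assert (Hd : qdot (q0 * d)%quat (q0 * d)%quat <> 0).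
      { rewrite qdot_mul; intros H.
        rewrite H in Hw; pose proof (qdot_sqr_ge0 (w1 - b)%quat) as Hwb.
        assert (E : w1 = b).
        { transitivity (w1 - b + b)%quat; [clear; quat_ring|].
          rewrite (qdot_eq0 (w1 - b)%quat) by lra; clear; quat_ring. }
        assert (Hd : qdot d d = (1 - qdot b b) ^ 2) by (unfold d; rewrite E; clear; quat_ring).
        rewrite Hd in H; apply Rmult_integral in H; destruct H as [H|H]; [lra|].
        apply pow_nonzero in H; [exact H|lra]. }
      (* The solution of [q0 d a = w1 - b]; for it, [|a| <= 1] is exactly the inequality [Hw]. *)
      set (a := (qinv (q0 * d) * (w1 - b))%quat); exists a.
      assert (Ea : (q0 * d * a = w1 - b)%quat).
      { unfold a; rewrite qmul_assoc, qinv_r by exact Hd; clear; quat_ring. }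
      assert (Ha : qdot a a <= 1).
      { pose proof (qdot_sqr_ge0 (q0 * d)%quat) as Hd0.
        apply (Rmult_le_reg_l (qdot (q0 * d)%quat (q0 * d)%quat)); [lra|].
        rewrite <- qdot_mul, Ea, Rmult_1_r, qdot_mul; exact Hw. }
      split; [exact Ha|]; intros x Hx.
      rewrite Ew; f_equal.
      apply (mobius_equation_unique (qconj b * a)%quat q0 (q0 * a + b)%quat); trivial.
      + rewrite qdot_mul.
        rewrite qdot_conj; pose proof (qdot_sqr_ge0 a); pose proof (qdot_sqr_ge0 b); nra.
      + transitivity (w1 - b + (q0 * w1 * (qconj b * a) + b))%quat;
          [generalize (q0 * w1 * (qconj b * a))%quat; clear; quat_ring|].
        rewrite <- Ea; unfold d; generalize a; clear; quat_ring. }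
  destruct Hcoef as (a & Ha & Hx).
  destruct (extremal_function a b Ha Hb) as (g & Hreg & Hder & Hg).
  exists (fun q => (q * g q)%quat); split; [exact Hreg|split; [|split; [|split]]].
  - intros q Hq1; pose proof (Hg q Hq1) as E; apply unit_ball_dot in Hq1.
    apply unit_ball_dot; rewrite qdot_mul.
    pose proof (mobius_equation_unit_ball a b q (g q) Ha Hb Hq1 E).
    pose proof (qdot_sqr_ge0 q); pose proof (qdot_sqr_ge0 (g q)); nra.
  - generalize (g 0); clear; quat_ring.
  - exact Hder.
  - symmetry; apply Hx, Hg, unit_ball_dot, Hq.
Qed.

Theorem theorem3p11 (q0 b : quat) (hq0 : unit_ball q0) (hb : unit_ball b) :
  let c : quat :=
    (q0 * b * ((1 - qnorm q0 ^ 2) / (1 - qnorm (q0 * b) ^ 2))%R)%quat in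
  let r : R :=
    qnorm q0 ^ 2 * (1 - qnorm b ^ 2) / (1 - qnorm (q0 * b)%quat ^ 2) in
  forall w : quat,
    (exists f : quat -> quat,
        slice_regular f /\
        (forall q : quat, unit_ball q -> unit_ball (f q)) /\
        f 0 = 0 /\
        is_slice_derivative f 0 b /\
        w = f q0) <->
    closed_ball c r w.
Proof.
  intros c r w; split.
  - intros (f & Hreg & Hball & H0 & Hd & ->).
    now apply slice_regular_value_in_ball.
  - now apply ball_value_attained.
Qed.
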